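(* Let $p\in(0,1]$ and let $E$ be a $p$-natural quasi-Banach space. Then the free vector lattice $\mathrm{FVL}[E]$ embeds as a norm dense subspace (sublattice) of $\mathrm{FpBL}^{(p)}[E]$: the unique linear lattice homomorphism $\mathrm{FVL}[E]\to\mathrm{FpBL}^{(p)}[E]$ extending the canonical embedding $\delta:E\to\mathrm{FpBL}^{(p)}[E]$ is injective and has norm dense range.
   Context: All spaces are real. A $p$-norm ($0<p\le1$) is a map $\|\cdot\|$ with $\|e\|=0\Rightarrow e=0$, $\|\lambda e\|=|\lambda|\|e\|$, $\|e+e'\|^p\le\|e\|^p+\|e'\|^p$; a quasi-norm satisfies instead of the last condition $\|e+e'\|\le\Delta(\|e\|+\|e'\|)$ for some $\Delta\ge1$. Complete $p$-normed (quasi-normed) spaces are $p$-Banach (quasi-Banach) spaces; those which are also vector lattices with $|x|\le|y|\Rightarrow\|x\|\le\|y\|$ are $p$-Banach (quasi-Banach) lattices. A quasi-Banach lattice $X$ is $p$-convex if there is $C>0$ with $\|(\sum_{k=1}^n|x_k|^p)^{1/p}\|\le C(\sum_{k=1}^n\|x_k\|^p)^{1/p}$ for all finite families in $X$; the infimum of such $C$ is $M^{(p)}(X)$. A quasi-Banach space is $p$-natural if it embeds linearly and isometrically into a $p$-convex $p$-Banach lattice $X$ with $M^{(p)}(X)=1$. For a $p$-natural $E$, $\mathrm{FpBL}^{(p)}[E]$ is the free $p$-convex $p$-Banach lattice generated by $E$: a $p$-convex $p$-Banach lattice with $M^{(p)}=1$ together with a linear isometric embedding $\delta:E\to\mathrm{FpBL}^{(p)}[E]$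 such that every continuous linear $T:E\to X$ into a $p$-convex $p$-Banach lattice $X$ admits a unique lattice homomorphism $\widehat T:\mathrm{FpBL}^{(p)}[E]\to X$ with $\widehat T\delta=T$, and $\|\widehat T\|\le M^{(p)}(X)\|T\|$ (it exists for every $p$-natural $E$ and is unique up to isometric lattice isomorphism). $\mathrm{FVL}[E]$ is the free vector lattice over the vector space $E$: a vector lattice with an injective linear map $E\to\mathrm{FVL}[E]$ such that every linear map from $E$ to a vector lattice $X$ extends uniquely to a linear lattice homomorphism $\mathrm{FVL}[E]\to X$. *)

(* Defs.v *)
From HB Require Import structures.
From mathcomp Require Import all_boot all_order all_algebra.
From mathcomp Require Import all_classical all_reals all_analysis.

Set Implicit Arguments.
Unset Strict Implicit.
Unset Printing Implicit Defensive.

Import Order.TTheory GRing.Theory Num.Theory.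
Import numFieldNormedType.Exports.

Local Open Scope classical_set_scope.
Local Open Scope ring_scope.

(* Joins and meets are part of the mixin, because the library's lattice
   structures cannot be combined with an additive structure on the same type. *)
HB.mixin Record isVectorLattice (R : realType) V
    of GRing.Lmodule R V & Num.POrderedZmodule V := {
  vjoin : V -> V -> V;
  vmeet : V -> V -> V;
  vjoinP : forall x y z : V, (vjoin x y <= z) = (x <= z) && (y <= z);
  vmeetP : forall x y z : V, (z <= vmeet x y) = (z <= x) && (z <= y);
  vlat_leD2r : forall z x y : V, x <= y -> x + z <= y + z;
  vlat_scale_ge0 : forall (a : R) (x : V), 0 <= a -> 0 <= x -> 0 <= a *: x
}.

#[short(type="vectorLatticeType")]
HB.structure Definition VectorLattice (R : realType) :=
  { V of GRing.Lmodule R V & Num.POrderedZmodule V & isVectorLattice R V }.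

Definition vabs (R : realType) (X : vectorLatticeType R) (x : X) : X :=
  vjoin x (- x).

Definition lattice_hom (R : realType) (X Y : vectorLatticeType R)
    (T : {linear X -> Y}) : Prop :=
  forall x y : X, T (vjoin x y) = vjoin (T x) (T y) /\
                  T (vmeet x y) = vmeet (T x) (T y).

(* The (quasi-, p-)norms below are plain functions rather than instances of the
   library's normed structures, since those impose the triangle inequality. *)
Section Norms.
Variables (R : realType) (E : lmodType R).
Implicit Types (N : E -> R) (p : R).

Definition p_norm p N : Prop :=
  [/\ forall e, 0 <= N e,
      forall e, N e = 0 -> e = 0,
      forall (a : R) e, N (a *: e) = `|a| * N e &
      forall e e', N (e + e') `^ p <= N e `^ p + N e' `^ p].

Definition quasi_norm N : Prop :=
  [/\ forall e, 0 <= N e,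
      forall e, N e = 0 -> e = 0,
      forall (a : R) e, N (a *: e) = `|a| * N e &
      exists2 D : R, 1 <= D & forall e e', N (e + e') <= D * (N e + N e')].

Definition norm_cauchy N (u : nat -> E) : Prop :=
  forall eps : R, 0 < eps -> exists K : nat,
    forall m n : nat, (K <= m)%N -> (K <= n)%N -> N (u m - u n) < eps.

Definition norm_converges N (u : nat -> E) (l : E) : Prop :=
  forall eps : R, 0 < eps -> exists K : nat,
    forall n : nat, (K <= n)%N -> N (u n - l) < eps.

Definition norm_complete N : Prop :=
  forall u : nat -> E, norm_cauchy N u -> exists l : E, norm_converges N u l.

Definition norm_dense N (A : set E) : Prop :=
  forall (e : E) (eps : R), 0 < eps -> exists2 a : E, A a & N (e - a) < eps.

Definition quasi_Banach N : Prop := quasi_norm N /\ norm_complete N.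

Definition p_Banach p N : Prop := p_norm p N /\ norm_complete N.

End Norms.

Section Operators.
Variables (R : realType) (E F : lmodType R) (NE : E -> R) (NF : F -> R).

Definition norm_continuous (T : E -> F) : Prop :=
  forall (x : E) (eps : R), 0 < eps -> exists2 d : R, 0 < d &
    forall y : E, NE (y - x) < d -> NF (T y - T x) < eps.

Definition isometric (T : E -> F) : Prop := forall e : E, NF (T e) = NE e.

(* Extended-real valued, so that the norm of an unbounded operator is +oo. *)
Definition opnorm (T : E -> F) : \bar R :=
  ereal_sup [set (NF (T e))%:E | e in [set e : E | NE e <= 1]].

End Operators.

Section Krivine.
Variables (R : realType) (X : vectorLatticeType R) (n : nat).

(* The domain of Krivine's functional calculus in n variables. *)
Definition homogeneous_continuous (h : 'rV[R]_n -> R) : Prop :=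
  continuous h /\
  forall (a : R) (t : 'rV[R]_n), 0 <= a -> h (a *: t) = a * h t.

(* [Phi] is a linear lattice homomorphism from the vector lattice of continuous
   positively homogeneous functions on R^n to X sending the k-th coordinate to
   [x k]; its values at all other functions are irrelevant.  By Krivine's
   theorem there is exactly one such homomorphism when X is a quasi-Banach
   lattice. *)
Definition Krivine_calculus (x : 'I_n -> X) (Phi : ('rV[R]_n -> R) -> X) :
    Prop :=
  (forall k : 'I_n, Phi (fun t => t ord0 k) = x k) /\
  (forall f g : 'rV[R]_n -> R,
     homogeneous_continuous f -> homogeneous_continuous g ->
     [/\ forall a : R, Phi (fun t => a * f t + g t) = a *: Phi f + Phi g,
         Phi (fun t => Num.max (f t) (g t)) = vjoin (Phi f) (Phi g) &
         Phi (fun t => Num.min (f t) (g t)) = vmeet (Phi f) (Phi g)]).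

(* [z] is the element (|x_1|^p + ... + |x_n|^p)^(1/p) of X. *)
Definition is_p_sum (p : R) (x : 'I_n -> X) (z : X) : Prop :=
  exists2 Phi, Krivine_calculus x Phi &
    z = Phi (fun t => (\sum_(k < n) `|t ord0 k| `^ p) `^ p^-1).

End Krivine.

Section Lattices.
Variables (R : realType) (X : vectorLatticeType R).
Implicit Types (N : X -> R) (p : R).

Definition lattice_norm N : Prop :=
  forall x y : X, vabs x <= vabs y -> N x <= N y.

Definition p_Banach_lattice p N : Prop := p_Banach p N /\ lattice_norm N.

Definition p_convexity_constant p N (C : R) : Prop :=
  0 < C /\
  forall (n : nat) (x : 'I_n -> X) (z : X), is_p_sum p x z ->
    N z <= C * (\sum_(k < n) N (x k) `^ p) `^ p^-1.

Definition p_convex p N : Prop := exists C : R, p_convexity_constant p N C.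

(* M^(p)(X) *)
Definition p_convexity p N : R := inf [set C | p_convexity_constant p N C].

Definition p_convex_p_Banach_lattice p N : Prop :=
  p_Banach_lattice p N /\ p_convex p N.

End Lattices.

Definition p_natural (R : realType) (p : R) (E : lmodType R) (NE : E -> R) :
    Prop :=
  exists (X : vectorLatticeType R) (NX : X -> R) (i : {linear E -> X}),
    [/\ p_convex_p_Banach_lattice p NX, p_convexity p NX = 1 &
        isometric NE NX i].

(* The bound [p_convexity p NF <= 1] is an equality whenever F is nonzero (take
   n = 1 in the definition of p-convexity).  For E = 0 the free lattice is the
   zero lattice, for which the infimum defining M^(p) is 0. *)
Definition is_FpBL (R : realType) (p : R) (E : lmodType R) (NE : E -> R)
    (F : vectorLatticeType R) (NF : F -> R) (delta : {linear E -> F}) : Prop :=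
  [/\ p_convex_p_Banach_lattice p NF,
      p_convexity p NF <= 1,
      isometric NE NF delta &
      forall (X : vectorLatticeType R) (NX : X -> R) (T : {linear E -> X}),
        p_convex_p_Banach_lattice p NX -> norm_continuous NE NX T ->
        exists That : {linear F -> X},
          [/\ lattice_hom That,
              forall e, That (delta e) = T e,
              forall S : {linear F -> X}, lattice_hom S ->
                (forall e, S (delta e) = T e) -> S =1 That &
              (opnorm NF NX That
               <= (p_convexity p NX)%:E * opnorm NE NX T)%E]].

Definition is_FVL (R : realType) (E : lmodType R) (V : vectorLatticeType R)
    (iota : {linear E -> V}) : Prop :=
  injective iota /\
  forall (X : vectorLatticeType R) (T : {linear E -> X}),
    exists That : {linear V -> X},
      [/\ lattice_hom That,
          forall e, That (iota e) = T e &
          forall S : {linear V -> X}, lattice_hom S ->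
            (forall e, S (iota e) = T e) -> S =1 That].

(* Main.v *)
Require Import Defs.
From HB Require Import structures.
From mathcomp Require finmap.
From mathcomp Require Import all_boot all_order all_algebra.
From mathcomp Require Import all_classical all_reals all_analysis.
From mathcomp Require Import ring lra.

Set Implicit Arguments.
Unset Strict Implicit.
Unset Printing Implicit Defensive.

Import Order.TTheory GRing.Theory Num.Theory.
Import numFieldNormedType.Exports.

Local Open Scope classical_set_scope.
Local Open Scope ring_scope.

(** Write [F] for the free p-convex p-Banach lattice on [E], and [j : V -> F] for
    the homomorphism extending [delta] to the free vector lattice [V].

    Density is formal.  The closure of the range of [j] is a closed sublattice of
    [F], hence itself a p-convex p-Banach lattice through which [delta] factors.
    The induced homomorphism from [F] to this closure, followed by the inclusion,
    fixes [delta E], so it is the identity of [F] by uniqueness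
    ([free_closure_range]).

    For injectivity it is enough to find one bounded operator [T : E -> X] into a
    p-convex p-Banach lattice whose extension to [V] is injective, because this
    extension factors through [j].  A p-natural space can have a trivial continuous
    dual, so [X] cannot be a lattice of functions on the continuous dual.  Instead
    the elements of [V] are seen as functions on the algebraic dual, and such a
    function [f] is given size at most [(sum_k |x_k|^p)^(1/p)] as soon as
    [|f phi|^p <= sum_k |phi x_k|^p] for every functional [phi], where the [x_k]
    are finitely many vectors of [E].  This size is p-convex by construction, and
    bounded sequences of functions modulo null sequences form a complete lattice
    ([gauge_p_convex_p_Banach_lattice]).  It remains to see that nonzero elements
    of [V] keep a nonzero size.

    - Every [v] in [V] is a finite join of finite meets of vectors of [E].  If [v]
      is not below [0], one of these meets is not, and Gordan's theorem of the
      alternative provides a functional [theta] bounded below by some [mu > 0] on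
      the finite set [s] of vectors in this meet ([FVL_not_le0]).  In particular
      [V] is ordered pointwise on the algebraic dual.
    - If [|phi a|^p <= sum_k |phi x_k|^p] for all [phi], then
      [|a|^p <= C * sum_k |x_k|^p] ([domination]).  Indeed the inequality between
      functions passes to [F], where [|delta a|] lies below the p-sum of the
      [delta x_k], and [F] is p-convex.  This uses Krivine's calculus on [delta E],
      which is built by approximating homogeneous continuous functions by
      lattice-linear ones ([lattice_linear_dense], [calculus_Krivine]).
    - By duality, there are functionals that are large at one vector and small on
      the [x_k].  Used once for every vector of [s], they provide functionals [phi]
      that agree with [theta] on [s] and satisfy
      [sum_k |phi x_k|^p <= K * sum_k |x_k|^p], with [K] independent of the [x_k]
      ([small_extension]).
    - If this [v] has size zero, its value at [phi] is at least [mu], although its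
      p-th power is at most [K * sum_k |x_k|^p], which can be made arbitrarily
      small ([null_le0]). *)

(** * Vector lattices *)

Section VectorLatticeTheory.
Variables (R : realType) (X : vectorLatticeType R).
Implicit Types (x y z : X) (a : R).

Lemma vjoin_ub x y : (x <= vjoin x y) /\ (y <= vjoin x y).
Proof. by have := vjoinP x y (vjoin x y); rewrite lexx => /esym/andP. Qed.

Lemma vmeet_lb x y : (vmeet x y <= x) /\ (vmeet x y <= y).
Proof. by have := vmeetP x y (vmeet x y); rewrite lexx => /esym/andP. Qed.

Lemma vle_joinl x y : x <= vjoin x y. Proof. by have [] := vjoin_ub x y. Qed.
Lemma vle_joinr x y : y <= vjoin x y. Proof. by have [] := vjoin_ub x y. Qed.
Lemma vle_meetl x y : vmeet x y <= x. Proof. by have [] := vmeet_lb x y. Qed.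
Lemma vle_meetr x y : vmeet x y <= y. Proof. by have [] := vmeet_lb x y. Qed.

Lemma vleD2rE z x y : (x + z <= y + z) = (x <= y).
Proof.
apply/idP/idP => [/(vlat_leD2r (- z))|]; last exact: vlat_leD2r.
by rewrite !addrK.
Qed.

Lemma vleD2lE z x y : (z + x <= z + y) = (x <= y).
Proof. by rewrite ![z + _]addrC vleD2rE. Qed.

Lemma vleD x y x' y' : x <= x' -> y <= y' -> x + y <= x' + y'.
Proof.
by move=> xx' yy'; apply: (@le_trans _ _ (x' + y)); rewrite ?vleD2rE ?vleD2lE.
Qed.

Lemma vleBlE x y z : (x - y <= z) = (x <= z + y).
Proof. by rewrite -(vleD2rE y (x - y)) subrK. Qed.

Lemma vleBrE x y z : (x <= y - z) = (x + z <= y).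
Proof. by rewrite -(vleD2rE z x) subrK. Qed.

Lemma vsub_ge0 x y : (0 <= y - x) = (x <= y).
Proof. by rewrite vleBrE add0r. Qed.

Lemma vsub_le0 x y : (x - y <= 0) = (x <= y).
Proof. by rewrite vleBlE add0r. Qed.

Lemma vleN2 x y : (- x <= - y) = (y <= x).
Proof. by rewrite -(vleD2rE (x + y) (- x)) addKr addrC addrK. Qed.

Lemma vaddr_ge0 x y : 0 <= x -> 0 <= y -> 0 <= x + y.
Proof. by move=> x0 y0; rewrite -[0]addr0 vleD. Qed.

Lemma vleZ a x y : 0 <= a -> x <= y -> a *: x <= a *: y.
Proof.
by move=> a0 xy; rewrite -vsub_ge0 -scalerBr vlat_scale_ge0// vsub_ge0.
Qed.

Lemma vscale_le_pos a x : 0 < a -> (a *: x <= 0) = (x <= 0).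
Proof.
move=> a0; apply/idP/idP => [ax|x0]; last first.
  by rewrite -(scaler0 _ a) vleZ// ltW.
rewrite -[x]scale1r -(mulVf (lt0r_neq0 a0)) -scalerA.
by rewrite -(scaler0 _ a^-1) vleZ// invr_ge0 ltW.
Qed.

Lemma vjoin_eq x y z : (forall w, (z <= w) = (x <= w) && (y <= w)) -> z = vjoin x y.
Proof.
move=> h; apply/le_anti; rewrite h vle_joinl vle_joinr/=.
by have := h z; rewrite lexx vjoinP => <-.
Qed.

Lemma vmeet_eq x y z : (forall w, (w <= z) = (w <= x) && (w <= y)) -> z = vmeet x y.
Proof.
move=> h; apply/le_anti; rewrite h vle_meetl vle_meetr/= andbT.
by have := h z; rewrite lexx vmeetP => <-.
Qed.

Lemma vjoinC x y : vjoin x y = vjoin y x.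
Proof. by apply: vjoin_eq => w; rewrite vjoinP andbC. Qed.

Lemma vmeetC x y : vmeet x y = vmeet y x.
Proof. by apply: vmeet_eq => w; rewrite vmeetP andbC. Qed.

Lemma vjoinA x y z : vjoin x (vjoin y z) = vjoin (vjoin x y) z.
Proof. by apply: vjoin_eq => w; rewrite !vjoinP andbA. Qed.

Lemma vmeetA x y z : vmeet x (vmeet y z) = vmeet (vmeet x y) z.
Proof. by apply: vmeet_eq => w; rewrite !vmeetP andbA. Qed.

Lemma vjoin_idr x y : (vjoin x y = y) <-> (x <= y).
Proof.
split=> [<-|xy]; first exact: vle_joinl.
apply/esym/vjoin_eq => w; apply/idP/andP => [yw|[]//]; split=> //.
exact: le_trans yw.
Qed.

Lemma vmeet_idl x y : (vmeet x y = x) <-> (x <= y).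
Proof.
split=> [<-|xy]; first exact: vle_meetr.
apply/esym/vmeet_eq => w; apply/idP/andP => [wx|[]//]; split=> //.
exact: le_trans xy.
Qed.

Lemma vjoinxx x : vjoin x x = x. Proof. exact/vjoin_idr. Qed.

Lemma vjoinK x y : vjoin x (vmeet x y) = x.
Proof. by rewrite vjoinC; apply/vjoin_idr; exact: vle_meetl. Qed.

Lemma vmeetK x y : vmeet x (vjoin x y) = x.
Proof. by apply/vmeet_idl; exact: vle_joinl. Qed.

Lemma vjoinDr x y z : vjoin (x + z) (y + z) = vjoin x y + z.
Proof. by apply/esym/vjoin_eq => w; rewrite -!vleBrE vjoinP. Qed.

Lemma vmeetDr x y z : vmeet (x + z) (y + z) = vmeet x y + z.
Proof. by apply/esym/vmeet_eq => w; rewrite -!vleBlE vmeetP. Qed.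

Lemma vopp_join x y : - vjoin x y = vmeet (- x) (- y).
Proof. by apply: vmeet_eq => w; rewrite -[w]opprK !vleN2 vjoinP. Qed.

Lemma vopp_meet x y : - vmeet x y = vjoin (- x) (- y).
Proof. by rewrite -[RHS]opprK vopp_join !opprK. Qed.

Lemma vmeetE x y : vmeet x y = - vjoin (- x) (- y).
Proof. by rewrite vopp_join !opprK. Qed.

Lemma vjoinZ a x y : 0 <= a -> a *: vjoin x y = vjoin (a *: x) (a *: y).
Proof.
rewrite le_eqVlt => /orP[/eqP<-|a0]; first by rewrite !scale0r vjoinxx.
have aV0 : a != 0 by rewrite gt_eqF.
apply: vjoin_eq => w.
have scaleE u : (a *: u <= w) = (u <= a^-1 *: w).
  apply/idP/idP => [h|h].
    by rewrite -[u]scale1r -(mulVf aV0) -scalerA vleZ// invr_ge0 ltW.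
  by rewrite -[w]scale1r -(mulfV aV0) -scalerA vleZ// ltW.
by rewrite !scaleE vjoinP.
Qed.

Lemma vmeetZ a x y : 0 <= a -> a *: vmeet x y = vmeet (a *: x) (a *: y).
Proof. by move=> a0; rewrite !vmeetE scalerN vjoinZ// !scalerN. Qed.

Lemma vjoin_meetD x y : vmeet x y + vjoin x y = x + y.
Proof.
have <- : vjoin (- x) (- y) + (x + y) = vjoin x y.
  by rewrite -vjoinDr addKr addrCA addNr addr0 vjoinC.
by rewrite vmeetE addKr.
Qed.

(** Vector lattices are distributive.  With [w] the right-hand side and [u] the
    join of the three elements, [vjoin_meetD] bounds both [x] and [y] by
    [w + u - z], hence bounds [vjoin x y] too, and [vjoin_meetD] turns this back
    into a bound on the meet. *)
Lemma vmeet_joinl x y z : vmeet (vjoin x y) z = vjoin (vmeet x z) (vmeet y z).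
Proof.
apply/le_anti/andP; split; last first.
  rewrite vjoinP !vmeetP vle_meetr (le_trans (vle_meetl _ _) (vle_joinl _ _)).
  by rewrite vle_meetr (le_trans (vle_meetl _ _) (vle_joinr _ _)).
set w := vjoin (vmeet x z) _; set u := vjoin (vjoin x y) z.
have -> : vmeet (vjoin x y) z = vjoin x y + z - u.
  by rewrite -[_ + z]vjoin_meetD addrK.
have H t : t <= vjoin x y -> vmeet t z <= w -> t <= w + u - z.
  move=> txy tw; rewrite vleBrE -vjoin_meetD vleD//.
  by rewrite vjoinP /u vle_joinr andbT (le_trans txy)// vle_joinl.
by rewrite vleBlE -vleBrE vjoinP !H ?vle_joinl ?vle_joinr.
Qed.

Lemma vabs_ge x : x <= vabs x. Proof. exact: vle_joinl. Qed.
Lemma vabs_geN x : - x <= vabs x. Proof. exact: vle_joinr. Qed.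

Lemma vabs_ge0 x : 0 <= vabs x.
Proof.
have : 0 <= vabs x + vabs x.
  by rewrite -(subrr x) vleD ?vabs_ge ?vabs_geN.
have -> : vabs x + vabs x = 2 *: vabs x by rewrite scaler_nat mulr2n.
by rewrite -vleN2 oppr0 -scalerN vscale_le_pos// -vleN2 opprK oppr0.
Qed.

Lemma vabs_le x y : (vabs x <= y) = (x <= y) && (- x <= y).
Proof. exact: vjoinP. Qed.

Lemma vabsN x : vabs (- x) = vabs x.
Proof. by rewrite /vabs opprK vjoinC. Qed.

Lemma vabsB x y : vabs (x - y) = vabs (y - x).
Proof. by rewrite -vabsN opprB. Qed.

Lemma ger0_vabs x : 0 <= x -> vabs x = x.
Proof.
move=> x0; rewrite /vabs vjoinC; apply/vjoin_idr/(le_trans _ x0).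
by rewrite -vleN2 opprK oppr0.
Qed.

Lemma vabs_id x : vabs (vabs x) = vabs x.
Proof. exact/ger0_vabs/vabs_ge0. Qed.

Lemma vabs0 : vabs (0 : X) = 0. Proof. exact: ger0_vabs. Qed.

Lemma vabs_join x y x' y' :
  vabs (vjoin x y - vjoin x' y') <= vabs (x - x') + vabs (y - y').
Proof.
have H (u v u' v' : X) : vjoin u v <= vabs (u - u') + vabs (v - v') + vjoin u' v'.
  rewrite vjoinP; apply/andP; split.
    rewrite -[u in leLHS](subrK u') -[leRHS]addrA vleD ?vabs_ge//.
    by rewrite -[u' in leLHS]add0r vleD ?vabs_ge0 ?vle_joinl.
  rewrite -[v in leLHS](subrK v') [_ + vabs _]addrC -[leRHS]addrA vleD ?vabs_ge//.
  by rewrite -[v' in leLHS]add0r vleD ?vabs_ge0 ?vle_joinr.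
by rewrite vabs_le opprB !vleBlE H/= (vabsB x) (vabsB y) H.
Qed.

Lemma vabs_meet x y x' y' :
  vabs (vmeet x y - vmeet x' y') <= vabs (x - x') + vabs (y - y').
Proof.
rewrite !vmeetE opprK -vabsN opprD opprK.
apply: (le_trans (vabs_join _ _ _ _)).
by rewrite !opprK ![- _ + _]addrC (vabsB x') (vabsB y').
Qed.

End VectorLatticeTheory.

Section LatticeHom.
Variables (R : realType) (X Y : vectorLatticeType R) (T : {linear X -> Y}).
Hypothesis homT : lattice_hom T.

Lemma hom_join x y : T (vjoin x y) = vjoin (T x) (T y).
Proof. by have [] := homT x y. Qed.

Lemma hom_meet x y : T (vmeet x y) = vmeet (T x) (T y).
Proof. by have [] := homT x y. Qed.

Lemma hom_abs x : T (vabs x) = vabs (T x).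
Proof. by rewrite /vabs hom_join linearN. Qed.

Lemma hom_le x y : x <= y -> T x <= T y.
Proof. by move=> /vjoin_idr xy; apply/vjoin_idr; rewrite -hom_join xy. Qed.

End LatticeHom.

Lemma lattice_hom_comp (R : realType) (X Y Z : vectorLatticeType R)
    (S : {linear Y -> Z}) (T : {linear X -> Y}) :
  lattice_hom S -> lattice_hom T -> lattice_hom (S \o T).
Proof. by move=> hS hT x y; rewrite /= !hom_join// !hom_meet. Qed.

(** * Subquotients and lattices of functions *)

(** The sublattice [sqA] modulo the ideal [sqI].  This one construction serves for
    the sublattice generated by [E] in the free vector lattice, for closed
    sublattices, and for bounded sequences modulo null sequences. *)
Record subquotient (R : realType) (X : vectorLatticeType R) := Subquotient {
  sqA : set X;
  sqI : set X;
  sqA0 : sqA 0;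
  sqAP : forall (a : R) x y, sqA x -> sqA y -> sqA (a *: x + y);
  sqA_join : forall x y, sqA x -> sqA y -> sqA (vjoin x y);
  sqI0 : sqI 0;
  sqIP : forall (a : R) x y, sqI x -> sqI y -> sqI (a *: x + y);
  sqI_solid : forall x y, vabs x <= vabs y -> sqI y -> sqI x }.

Section Subquotient.
Variables (R : realType) (X : vectorLatticeType R) (Q : subquotient X).
Implicit Types (x y z : X) (a : R).
Local Notation A := (sqA Q).
Local Notation I := (sqI Q).

Lemma sqAZ a x : A x -> A (a *: x).
Proof. by move=> Ax; rewrite -[_ *: _]addr0; apply: sqAP => //; exact: sqA0. Qed.

Lemma sqAD x y : A x -> A y -> A (x + y).
Proof. by move=> Ax Ay; rewrite -[x]scale1r; exact: sqAP. Qed.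

Lemma sqAN x : A x -> A (- x).
Proof. by rewrite -scaleN1r; exact: sqAZ. Qed.

Lemma sqA_meet x y : A x -> A y -> A (vmeet x y).
Proof.
by move=> Ax Ay; rewrite vmeetE; apply/sqAN/sqA_join; exact: sqAN.
Qed.

Lemma sqIZ a x : I x -> I (a *: x).
Proof. by move=> Ix; rewrite -[_ *: _]addr0; apply: sqIP => //; exact: sqI0. Qed.

Lemma sqID x y : I x -> I y -> I (x + y).
Proof. by move=> Ix Iy; rewrite -[x]scale1r; exact: sqIP. Qed.

Lemma sqIN x : I x -> I (- x).
Proof. by rewrite -scaleN1r; exact: sqIZ. Qed.

Lemma sqI_abs x : I (vabs x) <-> I x.
Proof. by split; apply: sqI_solid; rewrite vabs_id. Qed.

(** Classes are encoded by chosen representatives, so that the quotient is a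
    subtype of [X]. *)
Definition sq_rep x : X := xget 0 [set y | A y /\ I (y - x)].

Lemma sq_repP x : A x -> A (sq_rep x) /\ I (sq_rep x - x).
Proof.
move=> Ax; rewrite /sq_rep; case: xgetP => [y -> //|/(_ x)] /= [].
by split=> //; rewrite subrr; exact: sqI0.
Qed.

Lemma sq_rep_eq x y : I (x - y) -> sq_rep x = sq_rep y.
Proof.
move=> Ixy; rewrite /sq_rep; congr xget; apply/seteqP.
split=> z /= [Az Iz]; split=> //.
  by have := sqID Iz Ixy; rewrite addrA subrK.
by have := sqID Iz (sqIN Ixy); rewrite opprB addrA subrK.
Qed.

Record sqtype := SqType {
  sqval : X;
  sqvalP : `[< A sqval /\ sq_rep sqval = sqval >] }.

HB.instance Definition _ := [isSub for sqval].
HB.instance Definition _ := [Choice of sqtype by <:].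

Lemma sq_rep_mem x : A x -> `[< A (sq_rep x) /\ sq_rep (sq_rep x) = sq_rep x >].
Proof. by move=> /sq_repP[Ar Ir]; apply/asboolP; split=> //; exact: sq_rep_eq. Qed.

Definition sqcls x : sqtype := insubd (SqType (sq_rep_mem (sqA0 Q))) (sq_rep x).

Lemma sqval_cls x : A x -> sqval (sqcls x) = sq_rep x.
Proof. by move=> Ax; rewrite /sqcls (val_insubd _ (sq_rep x)) sq_rep_mem. Qed.

Lemma sqval_mem (s : sqtype) : A (sqval s).
Proof. by case: s => x /= /asboolP[]. Qed.

Lemma sqvalK (s : sqtype) : sqcls (sqval s) = s.
Proof.
apply: val_inj; rewrite /= sqval_cls; last exact: sqval_mem.
by case: s => x /= /asboolP[].
Qed.

Lemma sqcls_eq x y : A x -> A y -> (sqcls x = sqcls y) <-> I (x - y).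
Proof.
move=> Ax Ay; split=> [/(congr1 sqval)|Ixy]; last first.
  by apply: val_inj; rewrite /= !sqval_cls//; exact: sq_rep_eq.
rewrite !sqval_cls// => xy; have [_ Ix] := sq_repP Ax; have [_ Iy] := sq_repP Ay.
have -> : x - y = (sq_rep y - y) + - (sq_rep x - x).
  by rewrite xy opprB [RHS]addrC addrA subrK.
exact/sqID/sqIN.
Qed.

Lemma sqval_clsI x : A x -> I (sqval (sqcls x) - x).
Proof. by move=> Ax; rewrite sqval_cls//; have [] := sq_repP Ax. Qed.

Lemma sq_ind (P : sqtype -> Prop) : (forall x, A x -> P (sqcls x)) -> forall s, P s.
Proof. by move=> h s; rewrite -(sqvalK s); apply: h; exact: sqval_mem. Qed.

Definition sq_add (s t : sqtype) := sqcls (sqval s + sqval t).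
Definition sq_opp (s : sqtype) := sqcls (- sqval s).
Definition sq_scale a (s : sqtype) := sqcls (a *: sqval s).
Definition sq_join (s t : sqtype) := sqcls (vjoin (sqval s) (sqval t)).
Definition sq_meet (s t : sqtype) := sqcls (vmeet (sqval s) (sqval t)).
Definition sq_le (s t : sqtype) := `[< sq_join s t = t >].
Definition sq_lt (s t : sqtype) := (t != s) && sq_le s t.

Lemma sq_addE x y : A x -> A y -> sq_add (sqcls x) (sqcls y) = sqcls (x + y).
Proof.
move=> Ax Ay; apply/sqcls_eq; [exact/sqAD/sqval_mem/sqval_mem|exact: sqAD|].
by rewrite opprD addrACA; apply: sqID; exact: sqval_clsI.
Qed.

Lemma sq_scaleE a x : A x -> sq_scale a (sqcls x) = sqcls (a *: x).
Proof.
move=> Ax; apply/sqcls_eq; [exact/sqAZ/sqval_mem|exact: sqAZ|].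
by rewrite -scalerBr; apply: sqIZ; exact: sqval_clsI.
Qed.

Lemma sq_oppE x : A x -> sq_opp (sqcls x) = sqcls (- x).
Proof.
move=> Ax; rewrite -scaleN1r -sq_scaleE// /sq_scale /sq_opp.
by rewrite scaleN1r.
Qed.

Lemma sq_joinE x y : A x -> A y -> sq_join (sqcls x) (sqcls y) = sqcls (vjoin x y).
Proof.
move=> Ax Ay; apply/sqcls_eq; [exact/sqA_join/sqval_mem/sqval_mem|exact: sqA_join|].
apply: (sqI_solid (y := vabs (sqval (sqcls x) - x) + vabs (sqval (sqcls y) - y))).
  rewrite [leRHS]ger0_vabs ?vabs_join//.
  by apply: vaddr_ge0; exact: vabs_ge0.
by apply: sqID; apply/sqI_abs; exact: sqval_clsI.
Qed.

Lemma sq_meetE x y : A x -> A y -> sq_meet (sqcls x) (sqcls y) = sqcls (vmeet x y).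
Proof.
move=> Ax Ay; apply/sqcls_eq; [exact/sqA_meet/sqval_mem/sqval_mem|exact: sqA_meet|].
apply: (sqI_solid (y := vabs (sqval (sqcls x) - x) + vabs (sqval (sqcls y) - y))).
  rewrite [leRHS]ger0_vabs ?vabs_meet//.
  by apply: vaddr_ge0; exact: vabs_ge0.
by apply: sqID; apply/sqI_abs; exact: sqval_clsI.
Qed.

Let sqE := (sq_addE, sq_scaleE, sq_oppE, sq_joinE, sq_meetE).

Fact sq_addA : associative sq_add.
Proof.
by do 3![elim/sq_ind => ? ?]; rewrite !sqE ?addrA//; exact: sqAD.
Qed.

Fact sq_addC : commutative sq_add.
Proof. by do 2![elim/sq_ind => ? ?]; rewrite !sqE// addrC. Qed.

Fact sq_add0 : left_id (sqcls 0) sq_add.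
Proof. by elim/sq_ind => ? ?; rewrite sqE ?add0r//; exact: sqA0. Qed.

Fact sq_addN : left_inverse (sqcls 0) sq_opp sq_add.
Proof. by elim/sq_ind => ? ?; rewrite !sqE ?addNr//; exact: sqAN. Qed.

HB.instance Definition _ :=
  GRing.isZmodule.Build sqtype sq_addA sq_addC sq_add0 sq_addN.

Fact sq_scaleA a b (s : sqtype) : sq_scale a (sq_scale b s) = sq_scale (a * b) s.
Proof. by elim/sq_ind: s => ? ?; rewrite !sqE ?scalerA//; exact: sqAZ. Qed.

Fact sq_scale1 : left_id 1 sq_scale.
Proof. by elim/sq_ind => ? ?; rewrite sqE ?scale1r. Qed.

Fact sq_scaleDr : right_distributive sq_scale +%R.
Proof.
move=> a; do 2![elim/sq_ind => ? ?]; rewrite /GRing.add/= !sqE ?scalerDr//;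
  by [exact: sqAD|exact: sqAZ].
Qed.

Fact sq_scaleDl (s : sqtype) : {morph sq_scale^~ s : a b / a + b}.
Proof.
move=> a b; elim/sq_ind: s => ? ?; rewrite /GRing.add/= !sqE ?scalerDl//;
  exact: sqAZ.
Qed.

HB.instance Definition _ := GRing.Zmodule_isLmodule.Build R sqtype
  sq_scaleA sq_scale1 sq_scaleDr sq_scaleDl.

Fact sq_joinC : commutative sq_join.
Proof. by do 2![elim/sq_ind => ? ?]; rewrite !sqE// vjoinC. Qed.

Fact sq_joinA : associative sq_join.
Proof. by do 3![elim/sq_ind => ? ?]; rewrite !sqE ?vjoinA//; exact: sqA_join. Qed.

Fact sq_meetC : commutative sq_meet.
Proof. by do 2![elim/sq_ind => ? ?]; rewrite !sqE// vmeetC. Qed.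

Fact sq_meetA : associative sq_meet.
Proof. by do 3![elim/sq_ind => ? ?]; rewrite !sqE ?vmeetA//; exact: sqA_meet. Qed.

Fact sq_joinxx : idempotent_op sq_join.
Proof. by elim/sq_ind => ? ?; rewrite !sqE ?vjoinxx. Qed.

Fact sq_joinK s t : sq_join s (sq_meet s t) = s.
Proof.
elim/sq_ind: s => ? ?; elim/sq_ind: t => ? ?.
by rewrite !sqE ?vjoinK//; exact: sqA_meet.
Qed.

Fact sq_meetK s t : sq_meet s (sq_join s t) = s.
Proof.
elim/sq_ind: s => ? ?; elim/sq_ind: t => ? ?.
by rewrite !sqE ?vmeetK//; exact: sqA_join.
Qed.

Fact sq_lt_def s t : sq_lt s t = (t != s) && sq_le s t. Proof. by []. Qed.

Fact sq_le_refl : reflexive sq_le.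
Proof. by move=> s; apply/asboolP; exact: sq_joinxx. Qed.

Fact sq_le_anti : antisymmetric sq_le.
Proof. by move=> s t /andP[/asboolP st /asboolP]; rewrite sq_joinC st. Qed.

Fact sq_le_trans : transitive sq_le.
Proof.
move=> t s u /asboolP st /asboolP tu; apply/asboolP.
by rewrite -tu sq_joinA st.
Qed.

HB.instance Definition _ := Order.isPOrder.Build ring_display sqtype
  sq_lt_def sq_le_refl sq_le_anti sq_le_trans.

Fact sq_joinP (s t u : sqtype) : (sq_join s t <= u) = (s <= u) && (t <= u).
Proof.
apply/asboolP/andP => [stu|[/asboolP su /asboolP tu]]; last first.
  by rewrite -sq_joinA tu su.
split; apply/asboolP; rewrite -stu.
  by rewrite !sq_joinA sq_joinxx.
by rewrite (sq_joinC s) !sq_joinA sq_joinxx.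
Qed.

Let sq_le_meet (s t : sqtype) : (s <= t) <-> sq_meet s t = s.
Proof.
split=> [/asboolP<-|<-]; first by rewrite sq_meetK.
by apply/asboolP; rewrite sq_joinC sq_meetC sq_joinK.
Qed.

Fact sq_meetP (s t u : sqtype) : (u <= sq_meet s t) = (u <= s) && (u <= t).
Proof.
apply/idP/andP => [/sq_le_meet ust|[/sq_le_meet us /sq_le_meet ut]]; last first.
  by apply/sq_le_meet; rewrite sq_meetA us ut.
have idm (v : sqtype) : sq_meet v v = v by rewrite -{2}(sq_joinxx v) sq_meetK.
split; apply/sq_le_meet; rewrite -{1}ust -sq_meetA.
  by rewrite (sq_meetC _ s) (sq_meetA s) idm ust.
by rewrite -(sq_meetA s) idm ust.
Qed.

Fact sq_leD2r (u s t : sqtype) : s <= t -> s + u <= t + u.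
Proof.
move: u s t; do 3![elim/sq_ind => ? ?] => /asboolP h; apply/asboolP.
by rewrite -{2}h /GRing.add/= !sqE ?vjoinDr//; do ?[exact: sqAD | exact: sqA_join].
Qed.

Fact sq_scale_ge0 a (s : sqtype) : 0 <= a -> 0 <= s -> 0 <= a *: s.
Proof.
elim/sq_ind: s => x Ax a0 /asboolP h; apply/asboolP.
have A0 := sqA0 Q; move: h; rewrite /GRing.scale/GRing.zero/= !sqE//; last exact: sqAZ.
move=> h; rewrite -[X in sqcls (vjoin X _)](scaler0 _ a) -vjoinZ//.
by rewrite -sq_scaleE ?h ?sq_scaleE//; exact: sqA_join.
Qed.

HB.instance Definition _ := isVectorLattice.Build R sqtype
  sq_joinP sq_meetP sq_leD2r sq_scale_ge0.

Lemma sqclsP a x y : A x -> A y ->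
  [/\ sqcls (a *: x + y) = a *: sqcls x + sqcls y,
      sqcls (vjoin x y) = vjoin (sqcls x) (sqcls y) &
      sqcls (vmeet x y) = vmeet (sqcls x) (sqcls y)].
Proof.
move=> Ax Ay; split; last 2 first.
- by rewrite -sq_joinE.
- by rewrite -sq_meetE.
by rewrite -sq_addE -?sq_scaleE//; exact: sqAZ.
Qed.

Lemma sqcls0 : sqcls 0 = 0. Proof. by []. Qed.

Lemma sqcls_abs x : A x -> sqcls (vabs x) = vabs (sqcls x).
Proof.
move=> Ax; have [_ -> _] := sqclsP 0 Ax (sqAN Ax).
by rewrite /vabs; congr vjoin; rewrite -sq_oppE.
Qed.

End Subquotient.

Section FunctionLattice.
Variables (R : realType) (S : Type).

(** An alias keeps the pointwise structures declared below apart from those already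
    attached to the function type. *)
Definition fnlat := S -> R.

HB.instance Definition _ := gen_eqMixin fnlat.
HB.instance Definition _ := gen_choiceMixin fnlat.

Implicit Types (f g h : fnlat) (a : R).

Definition fn_add f g : fnlat := fun s => f s + g s.
Definition fn_opp f : fnlat := fun s => - f s.
Definition fn_scale a f : fnlat := fun s => a * f s.
Definition fn_le f g := `[< forall s, f s <= g s >].
Definition fn_lt f g := (g != f) && fn_le f g.
Definition fn_join f g : fnlat := fun s => Num.max (f s) (g s).
Definition fn_meet f g : fnlat := fun s => Num.min (f s) (g s).

Fact fn_addA : associative fn_add.
Proof. by move=> f g h; apply/funext => s; exact: addrA. Qed.
Fact fn_addC : commutative fn_add.
Proof. by move=> f g; apply/funext => s; exact: addrC. Qed.
Fact fn_add0 : left_id (fun=> 0 : R) fn_add.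
Proof. by move=> f; apply/funext => s; exact: add0r. Qed.
Fact fn_addN : left_inverse (fun=> 0 : R) fn_opp fn_add.
Proof. by move=> f; apply/funext => s; exact: addNr. Qed.

HB.instance Definition _ :=
  GRing.isZmodule.Build fnlat fn_addA fn_addC fn_add0 fn_addN.

Fact fn_scaleA a b f : fn_scale a (fn_scale b f) = fn_scale (a * b) f.
Proof. by apply/funext => s; exact: mulrA. Qed.
Fact fn_scale1 : left_id 1 fn_scale.
Proof. by move=> f; apply/funext => s; exact: mul1r. Qed.
Fact fn_scaleDr : right_distributive fn_scale +%R.
Proof. by move=> a f g; apply/funext => s; exact: mulrDr. Qed.
Fact fn_scaleDl f : {morph fn_scale^~ f : a b / a + b}.
Proof. by move=> a b; apply/funext => s; exact: mulrDl. Qed.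

HB.instance Definition _ := GRing.Zmodule_isLmodule.Build R fnlat
  fn_scaleA fn_scale1 fn_scaleDr fn_scaleDl.

Fact fn_lt_def f g : fn_lt f g = (g != f) && fn_le f g. Proof. by []. Qed.
Fact fn_le_refl : reflexive fn_le.
Proof. by move=> f; apply/asboolP => s. Qed.
Fact fn_le_anti : antisymmetric fn_le.
Proof.
move=> f g /andP[/asboolP fg /asboolP gf]; apply/funext => s.
by apply/le_anti; rewrite fg gf.
Qed.
Fact fn_le_trans : transitive fn_le.
Proof.
move=> g f h /asboolP fg /asboolP gh; apply/asboolP => s.
exact: (le_trans (fg s)).
Qed.

HB.instance Definition _ := Order.isPOrder.Build ring_display fnlat
  fn_lt_def fn_le_refl fn_le_anti fn_le_trans.

Fact fn_joinP f g h : (fn_join f g <= h) = (f <= h) && (g <= h).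
Proof.
apply/asboolP/andP => [fgh|[/asboolP fh /asboolP gh] s]; last first.
  by rewrite /fn_join ge_max fh gh.
by split; apply/asboolP => s; have := fgh s; rewrite ge_max => /andP[].
Qed.

Fact fn_meetP f g h : (h <= fn_meet f g) = (h <= f) && (h <= g).
Proof.
apply/asboolP/andP => [fgh|[/asboolP fh /asboolP gh] s]; last first.
  by rewrite /fn_meet le_min fh gh.
by split; apply/asboolP => s; have := fgh s; rewrite le_min => /andP[].
Qed.

Fact fn_leD2r h f g : f <= g -> f + h <= g + h.
Proof. by move=> /asboolP fg; apply/asboolP => s; rewrite lerD2r. Qed.

Fact fn_scale_ge0 a f : 0 <= a -> 0 <= f -> 0 <= a *: f.
Proof. by move=> a0 /asboolP f0; apply/asboolP => s; exact/mulr_ge0/f0. Qed.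

HB.instance Definition _ := isVectorLattice.Build R fnlat
  fn_joinP fn_meetP fn_leD2r fn_scale_ge0.

Lemma fn_leP f g : reflect (forall s, f s <= g s) (f <= g).
Proof. exact: asboolP. Qed.

Lemma fn_absE f s : vabs f s = `|f s|.
Proof. by rewrite -[RHS]maxNr maxC. Qed.

End FunctionLattice.

(** * The order of the free vector lattice *)

Lemma linear_of (R : realType) (U W : lmodType R) (f : U -> W) :
  (forall (a : R) x y, f (a *: x + y) = a *: f x + f y) ->
  exists T : {linear U -> W}, forall x, T x = f x.
Proof.
move=> lf.
pose T : {linear U -> W} := HB.pack f (GRing.isLinear.Build R U W *:%R f lf).
by exists T.
Qed.

Lemma scalar_of (R : realType) (U : lmodType R) (f : U -> R) :
  (forall (a : R) x y, f (a *: x + y) = a * f x + f y) ->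
  exists T : {scalar U}, forall x, T x = f x.
Proof.
move=> lf.
pose T : {scalar U} := HB.pack f (GRing.isLinear.Build R U R *%R f lf).
by exists T.
Qed.

Lemma scalar_comb (R : realType) (U : lmodType R) (phi psi : {scalar U}) (t : R) :
  exists chi : {scalar U}, forall x, chi x = phi x + t * psi x.
Proof.
by apply: scalar_of => a x y; rewrite !linearP/=; ring.
Qed.

Section Sublattice.
Variables (R : realType) (X : vectorLatticeType R) (A : set X).
Hypothesis A0 : A 0.
Hypothesis AP : forall (a : R) x y, A x -> A y -> A (a *: x + y).
Hypothesis A_join : forall x y, A x -> A y -> A (vjoin x y).

Definition sublattice : subquotient X.
Proof.
apply: (@Subquotient R X A [set 0]) => //=.
  by move=> a x y -> ->; rewrite scaler0 addr0.
move=> x y + y0; rewrite y0 vabs0 => x0; apply/le_anti.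
by rewrite (le_trans (vabs_ge x))//= -vleN2 oppr0 (le_trans (vabs_geN x)).
Defined.

Lemma sub_clsK x : A x -> sqval (sqcls sublattice x) = x.
Proof. by move=> Ax; apply/subr0_eq; exact: (sqval_clsI (Q := sublattice)). Qed.

Lemma sub_incl : exists i : {linear sqtype sublattice -> X},
  lattice_hom i /\ forall s, i s = sqval s.
Proof.
have [a s t|i iE] := @linear_of R (sqtype sublattice) X (@sqval _ _ _).
  elim/sq_ind: s => x Ax; elim/sq_ind: t => y Ay.
  have [<- _ _] := sqclsP a Ax Ay.
  by rewrite !sub_clsK//; exact: AP.
exists i; split=> // s t; rewrite !iE.
elim/sq_ind: s => x Ax; elim/sq_ind: t => y Ay.
have [_ <- <-] := sqclsP 0 Ax Ay.
by rewrite !sub_clsK//; [exact: (sqA_meet (Q := sublattice))|exact: A_join].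
Qed.

End Sublattice.

Lemma sq_lift (R : realType) (X : vectorLatticeType R) (Q : subquotient X)
    (E : lmodType R) (T : {linear E -> X}) : (forall e, sqA Q (T e)) ->
  exists c : {linear E -> sqtype Q}, forall e, c e = sqcls Q (T e).
Proof.
move=> QT; apply: linear_of => a x y.
by rewrite linearP; have [-> _ _] := sqclsP a (QT x) (QT y).
Qed.

Section AlgebraicDual.
Variables (R : realType) (E : lmodType R).
Implicit Types (e x : E) (s : seq E).

(** A set maximal among the linearly closed ones that avoid [e] is a hyperplane:
    adjoining any vector outside it captures [e].  The functional is the
    coordinate along [e]. *)
Lemma scalar_separates e : e != 0 -> exists phi : {scalar E}, phi e != 0.
Proof.
move=> e0.
pose P (A : set E) := ~ A e /\ forall (a : R) x y, A x -> A y -> A (a *: x + y).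
have [F FP totF|A [[Ae AP] maxA]] := @Zorn_bigcup E P.
  split=> [[G FG Ge]|a x y [G FG Gx] [H FH Hy]]; first by have [] := FP _ FG.
  have [GH|HG] := totF _ _ FG FH.
    by exists H => //; have [_] := FP _ FH; apply => //; exact: GH.
  by exists G => //; have [_] := FP _ FG; apply => //; exact: HG.
have A0 : A 0.
  apply: contrapT => nA0.
  have nA x : ~ A x by move=> Ax; apply: nA0; rewrite -(addNr x) -scaleN1r; exact: AP.
  apply: (maxA [set 0]); last first.
    by split=> [/= /eqP|a x y -> ->]; rewrite ?(negbTE e0)// scaler0 addr0.
  by split=> [x /nA//|h]; apply: nA0; exact: h.
have AZ (a : R) x : A x -> A (a *: x).
  by move=> Ax; rewrite -[_ *: _]addr0; exact: AP.
have /choice[f fP] : forall x, exists c : R, A (x - c *: e).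
  move=> x; have [Ax|nAx] := pselect (A x); first by exists 0; rewrite scale0r subr0.
  pose B := [set y | exists u (c : R), A u /\ y = u + c *: x].
  have BP (a : R) y z : B y -> B z -> B (a *: y + z).
    move=> [u [c [Au ->]]] [v [d [Av ->]]]; exists (a *: u + v), (a * c + d).
    by split; [exact: AP|rewrite scalerDr scalerA scalerDl addrACA].
  have [[u [c [Au ec]]]|nBe] := pselect (B e); last first.
    exfalso; apply: (maxA B); first split.
    - by move=> y Ay; exists y, 0; split=> //; rewrite scale0r addr0.
    - move=> BA; apply: nAx; apply: BA; exists 0, 1; split=> //.
      by rewrite scale1r add0r.
    - by split=> //.
  have c0 : c != 0 by apply: contra_notN Ae => /eqP c0; rewrite ec c0 scale0r addr0.
  exists c^-1.
  have -> : x - c^-1 *: e = - c^-1 *: u.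
    by rewrite ec scalerDr scalerA mulVf// scale1r opprD addrCA subrr addr0 scaleNr.
  exact: AZ.
have fU x c : A (x - c *: e) -> f x = c.
  move=> Ac; apply/eqP; rewrite -subr_eq0; apply: contra_notT Ae => fc0.
  have : A ((-1) *: (x - f x *: e) + (x - c *: e)) by exact: AP.
  rewrite scaleN1r opprB subrKA -scalerBl => /(AZ (f x - c)^-1).
  by rewrite scalerA mulVf// scale1r.
have [a x y|phi phiE] := @scalar_of R E f.
  apply: fU.
  have -> : a *: x + y - (a * f x + f y) *: e = a *: (x - f x *: e) + (y - f y *: e).
    by rewrite scalerBr scalerDl scalerA opprD addrACA.
  exact: AP.
exists phi; rewrite phiE (fU e 1) ?oner_eq0//.
by rewrite scale1r subrr.
Qed.

Lemma scalar_pos_perturb s (phi psi : {scalar E}) :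
  (forall x, x \in s -> 0 < phi x) ->
  exists2 t : R, 0 < t & forall x, x \in s -> 0 < phi x + t * psi x.
Proof.
elim: s => [|x s ih] phis; first by exists 1.
have [y ys|t t0 ts] := ih; first by apply: phis; rewrite inE ys orbT.
have px : 0 < phi x by apply: phis; rewrite mem_head.
pose t' := Num.min t (phi x / (`|psi x| + 1)).
have n0 : 0 < `|psi x| + 1 by rewrite ltr_wpDl.
have t'0 : 0 < t' by rewrite lt_min t0 divr_gt0.
exists t' => // y; rewrite inE => /orP[/eqP->|ys].
  have : t' * (`|psi x| + 1) <= phi x by rewrite -ler_pdivlMr// ge_min lexx orbT.
  have : - `|psi x| <= psi x by rewrite lerNl -normrN ler_norm.
  by nra.
have := ts _ ys; have : 0 < phi y by apply: phis; rewrite inE ys orbT.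
have : t' <= t by rewrite ge_min lexx.
by nra.
Qed.

End AlgebraicDual.

Lemma finite_lower_bound (R : realType) (T : eqType) (s : seq T) (f : T -> R) :
  (forall x, x \in s -> 0 < f x) ->
  exists2 mu : R, 0 < mu & forall x, x \in s -> mu <= f x.
Proof.
elim: s => [|x s ih] fs; first by exists 1.
have [y ys|mu mu0 mus] := ih; first by apply: fs; rewrite inE ys orbT.
exists (Num.min mu (f x)); first by rewrite lt_min mu0 fs// mem_head.
move=> y; rewrite inE ge_min => /orP[/eqP->|/mus->//].
by rewrite lexx orbT.
Qed.

Section Gordan.
Variables (R : realType) (E : lmodType R) (Y : vectorLatticeType R).
Variable T : {linear E -> Y}.

(** The second alternative is what a nontrivial relation with nonnegative
    coefficients between the elements of [s] implies in any vector lattice.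

    Let [phi] be positive on the tail of [s] and negative at its head [e].  Replace
    each [x] of the tail by the convex combination [pr x] of [x] and [e] that [phi]
    annihilates.  A common lower bound of [x] and [e] is one of [pr x], and a
    functional positive at every [pr x], corrected by a multiple of [phi] so as to
    vanish at [e], is positive on the tail.  This leaves functionals that are
    positive on the tail and vanish at [e], which a perturbation makes positive
    at [e]. *)
Lemma Gordan (s : seq E) :
  (exists phi : {scalar E}, forall x, x \in s -> 0 < phi x) \/
  (forall w : Y, (forall x, x \in s -> w <= T x) -> w <= 0).
Proof.
have [n] := ubnP (size s); elim: n => // n ih in s *.
case: s => [_|e s /= sn].
  by left; have [|phi _] := @scalar_of R E (fun=> 0); [move=> *; ring|exists phi].
have [[phi phis]|ws] := ih s sn; last first.
  by right=> w we; apply: ws => x xs; apply: we; rewrite inE xs orbT.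
have tie (psi : {scalar E}) : (forall x, x \in s -> 0 < psi x) -> psi e = 0 ->
    (exists phi : {scalar E}, forall x, x \in e :: s -> 0 < phi x) \/
    (forall w : Y, (forall x, x \in e :: s -> w <= T x) -> w <= 0).
  move=> psis psie; have [e0|/scalar_separates[chi chie]] := eqVneq e 0.
    by right=> w /(_ e); rewrite mem_head e0 linear0; exact.
  (* [chi' = chi e *: chi] takes the value [(chi e) ^+ 2] at [e]. *)
  have [chi' chi'E] := scalar_comb chi chi (chi e - 1).
  have chi'e : 0 < chi' e.
    by rewrite chi'E -[X in X + _]mul1r -mulrDl addrC subrK -expr2 exprn_even_gt0.
  left; have [t t0 ts] := scalar_pos_perturb chi' psis.
  have [xi xiE] := scalar_comb psi chi' t; exists xi => x; rewrite inE xiE.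
  by move=> /orP[/eqP->|/ts//]; rewrite psie add0r mulr_gt0.
have [phie|phie|phie] := ltgtP (phi e) 0; last exact: (tie phi).
  pose c x := (phi x - phi e)^-1.
  have c0 x : x \in s -> 0 < c x.
    by move=> /phis px; rewrite invr_gt0 subr_gt0 (lt_trans phie).
  pose pr x := (c x * - phi e) *: x + (c x * phi x) *: e.
  have [|[psi psis]|ws] := ih (map pr s); first by rewrite size_map.
    have [xi xiE] := scalar_comb psi phi (- (psi e / phi e)).
    apply: (tie xi) => [x xs|]; last by rewrite xiE; field; rewrite lt_eqF.
    have := psis _ (map_f pr xs); rewrite linearP linearZ/= => h.
    have e0 : phi e != 0 by rewrite lt_eqF.
    have -> : xi x = (c x * - phi e * psi x + c x * phi x * psi e) / (c x * - phi e).
      by rewrite xiE; field; rewrite ?e0 /= gt_eqF ?c0.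
    by rewrite divr_gt0// mulr_gt0 ?c0// oppr_gt0.
  right=> w we; apply: ws => _ /mapP[x xs ->]; rewrite linearP linearZ/=.
  have -> : w = (c x * - phi e) *: w + (c x * phi x) *: w.
    rewrite -scalerDl -mulrDr addrC mulVf ?scale1r//.
    by have := c0 _ xs; rewrite invr_gt0 => /lt0r_neq0.
  have cx0 := c0 _ xs; have px0 := phis _ xs.
  apply: vleD; apply: vleZ.
  - by rewrite mulr_ge0 ?ltW// oppr_gt0.
  - by apply: we; rewrite inE xs orbT.
  - by rewrite mulr_ge0 ?ltW.
  - by apply: we; rewrite mem_head.
by left; exists phi => x; rewrite inE => /orP[/eqP->|/phis].
Qed.

End Gordan.

Section Generated.
Variables (R : realType) (E : lmodType R) (V : vectorLatticeType R).
Variable iota : {linear E -> V}.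

(** By distributivity, joins of meets of generators are stable under all operations.
    In this normal form, being below [0] is decided meet by meet. *)
Inductive meets : V -> Prop :=
| meets_gen e : meets (iota e)
| meets_meet v w : meets v -> meets w -> meets (vmeet v w).

Inductive joins : V -> Prop :=
| joins_meets v : meets v -> joins v
| joins_join v w : joins v -> joins w -> joins (vjoin v w).

Lemma meetsD v w : meets v -> meets w -> meets (v + w).
Proof.
elim=> [e|v1 v2 _ ih1 _ ih2] mw; last by rewrite -vmeetDr; apply: meets_meet; auto.
elim: mw => [f|w1 w2 _ ih1 _ ih2]; first by rewrite -linearD; exact: meets_gen.
by rewrite addrC -vmeetDr; apply: meets_meet; rewrite addrC.
Qed.

Lemma joinsD v w : joins v -> joins w -> joins (v + w).
Proof.
elim=> [v' mv|v1 v2 _ ih1 _ ih2] jw; last by rewrite -vjoinDr; apply: joins_join; auto.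
elim: jw => [w' mw|w1 w2 _ ih1 _ ih2]; first exact/joins_meets/meetsD.
by rewrite addrC -vjoinDr; apply: joins_join; rewrite addrC.
Qed.

Lemma joins_vmeet v w : joins v -> joins w -> joins (vmeet v w).
Proof.
elim=> [v' mv|v1 v2 _ ih1 _ ih2] jw; last by rewrite vmeet_joinl; apply: joins_join; auto.
elim: jw => [w' mw|w1 w2 _ ih1 _ ih2]; first exact/joins_meets/meets_meet.
by rewrite vmeetC vmeet_joinl; apply: joins_join; rewrite vmeetC.
Qed.

Lemma joins_gen e : joins (iota e). Proof. exact/joins_meets/meets_gen. Qed.

Lemma joinsN v : joins v -> joins (- v).
Proof.
elim=> [w|v1 v2 _ ih1 _ ih2]; last by rewrite vopp_join; exact: joins_vmeet.
elim=> [e|v1 v2 _ ih1 _ ih2]; first by rewrite -linearN; exact: joins_gen.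
by rewrite vopp_meet; exact: joins_join.
Qed.

Lemma joinsZ (a : R) v : joins v -> joins (a *: v).
Proof.
have pos (b : R) w : 0 <= b -> joins w -> joins (b *: w).
  move=> b0; elim=> [w'|v1 v2 _ ih1 _ ih2]; last by rewrite vjoinZ//; exact: joins_join.
  elim=> [e|v1 v2 _ ih1 _ ih2]; first by rewrite -linearZ; exact: joins_gen.
  by rewrite vmeetZ//; exact: joins_vmeet.
have [a0|a0] := lerP 0 a; first exact: pos.
by move=> jv; rewrite -[a]opprK scaleNr; apply/joinsN/pos => //; rewrite oppr_ge0 ltW.
Qed.

Lemma joins0 : joins 0. Proof. by rewrite -(linear0 iota); exact: joins_gen. Qed.

(** [s] lists the generators whose meet is [v]; the second clause expresses that [v]
    is their greatest lower bound through real values, the form in which it is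
    used. *)
Lemma meets_bounds v : meets v -> exists s : seq E,
  (forall x, x \in s -> v <= iota x) /\
  (forall S (h : {linear V -> fnlat R S}), lattice_hom h ->
    forall t w, (forall x, x \in s -> w <= h (iota x) t) -> w <= h v t).
Proof.
elim=> [e|v1 v2 _ [s1 [v1s s1v]] _ [s2 [v2s s2v]]].
  exists [:: e]; split=> [x|S h hh t w ws]; first by rewrite inE => /eqP->.
  by apply: ws; rewrite inE.
exists (s1 ++ s2); split=> [x|S h hh t w ws].
  rewrite mem_cat => /orP[/v1s|/v2s]; apply: le_trans;
    [exact: vle_meetl|exact: vle_meetr].
rewrite hom_meet//; change (w <= Num.min (h v1 t) (h v2 t)); rewrite le_min s1v ?s2v// => x xs; apply: ws;
  by rewrite mem_cat xs ?orbT.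
Qed.

Hypothesis V_free : is_FVL iota.

Lemma FVL_extension (X : vectorLatticeType R) (T : {linear E -> X}) :
  exists2 h : {linear V -> X}, lattice_hom h & forall e, h (iota e) = T e.
Proof. by have [_ /(_ X T)[h [? ? _]]] := V_free; exists h. Qed.

Lemma FVL_unique (X : vectorLatticeType R) (S T : {linear V -> X}) :
  lattice_hom S -> lattice_hom T -> (forall e, S (iota e) = T (iota e)) -> S =1 T.
Proof.
move=> hS hT ST; have [_ /(_ X (T \o iota))[h [_ _ hU]]] := V_free.
by move=> v; rewrite (hU S)// (hU T).
Qed.

(** The extension of [iota] to a homomorphism into the sublattice of joins of meets,
    followed by the inclusion, is the identity by uniqueness. *)
Lemma FVL_joins v : joins v.
Proof.
pose Q := sublattice joins0
  (fun a x y (jx : joins x) (jy : joins y) => joinsD (joinsZ a jx) jy) joins_join.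
have [c cE] := @sq_lift R V Q E iota joins_gen.
have [i [hi iE]] : exists i : {linear sqtype Q -> V},
    lattice_hom i /\ forall s, i s = sqval s by exact: sub_incl.
have [h hh hE] := FVL_extension c.
have [_ /(_ V iota)[k [_ _ kU]]] := V_free.
have idV : lattice_hom (idfun : {linear V -> V}) by [].
have -> : v = i (h v).
  rewrite -[LHS]/(idfun v) (FVL_unique (T := i \o h) idV)//.
    exact: lattice_hom_comp.
  by move=> e; rewrite /= hE cE iE sub_clsK//; exact: joins_gen.
by rewrite iE; exact: (sqval_mem (Q := Q)).
Qed.

(** Some meet in the normal form of [v] is not below [0], which excludes the second
    alternative of [Gordan] for its generators. *)
Lemma FVL_not_le0 v : ~ (v <= 0) ->
  exists (s : seq E) (theta : {scalar E}) (mu : R),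
  [/\ 0 < mu, forall x, x \in s -> mu <= theta x &
      forall S (h : {linear V -> fnlat R S}), lattice_hom h ->
      forall t w, (forall x, x \in s -> w <= h (iota x) t) -> w <= h v t].
Proof.
elim: (FVL_joins v) => [w mw|v1 v2 _ ih1 _ ih2].
  have [s [ws sw]] := meets_bounds mw => nw.
  have [[theta thetas]|/(_ _ ws)//] := Gordan iota s.
  by have [mu mu0 mus] := finite_lower_bound thetas; exists s, theta, mu.
move=> nv; have [v10|/ih1[s [theta [mu [? ? h]]]]] := pselect (v1 <= 0); last first.
  exists s, theta, mu; split=> // S k hk t w /(h _ _ hk) /le_trans; apply.
  by apply/fn_leP: t; apply: hom_le => //; exact: vle_joinl.
have [v20|/ih2[s [theta [mu [? ? h]]]]] := pselect (v2 <= 0); last first.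
  exists s, theta, mu; split=> // S k hk t w /(h _ _ hk) /le_trans; apply.
  by apply/fn_leP: t; apply: hom_le => //; exact: vle_joinr.
by exfalso; apply: nv; rewrite vjoinP v10.
Qed.

Definition evaluation : E -> fnlat R {scalar E} := fun e phi => phi e.

Lemma evaluation_linear (a : R) x y :
  evaluation (a *: x + y) = a *: evaluation x + evaluation y.
Proof. by apply/funext => phi; rewrite /evaluation linearP. Qed.

Lemma FVL_as_functions : exists2 hat : {linear V -> fnlat R {scalar E}},
  lattice_hom hat & forall e phi, hat (iota e) phi = phi e.
Proof.
have [ev evE] := linear_of evaluation_linear.
have [hat hh hatE] := FVL_extension ev; exists hat => // e phi.
by rewrite hatE evE.
Qed.

(** The functional [theta] found for [v - w] would be a point where the function of
    [v] exceeds that of [w]. *)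
Lemma FVL_le_pointwise (hat : {linear V -> fnlat R {scalar E}}) v w :
  lattice_hom hat -> (forall e phi, hat (iota e) phi = phi e) ->
  (forall phi, hat v phi <= hat w phi) -> v <= w.
Proof.
move=> hh hatE vw; rewrite -vsub_le0; apply: contrapT => /FVL_not_le0.
move=> [s [theta [mu [mu0 mus /(_ _ _ hh theta mu)]]]].
rewrite linearB/= => h; have : mu <= hat v theta - hat w theta.
  by apply: h => x xs; rewrite hatE mus.
by have := vw theta; lra.
Qed.

End Generated.

(** * Approximation of homogeneous functions *)

Section LatticeLinear.
Variables (R : realType) (n : nat).
Implicit Types (f g h : 'rV[R]_n -> R) (t s : 'rV[R]_n) (a : R).

(** The functions whose value under a Krivine calculus is determined by the algebra
    alone.  [ll_zero] matters for [n = 0], when there is no coordinate. *)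
Inductive lattice_linear : ('rV[R]_n -> R) -> Prop :=
| ll_zero : lattice_linear (fun=> 0)
| ll_coord k : lattice_linear (fun t => t ord0 k)
| ll_lin a f g : lattice_linear f -> lattice_linear g ->
    lattice_linear (fun t => a * f t + g t)
| ll_max f g : lattice_linear f -> lattice_linear g ->
    lattice_linear (fun t => Num.max (f t) (g t))
| ll_min f g : lattice_linear f -> lattice_linear g ->
    lattice_linear (fun t => Num.min (f t) (g t)).

Lemma hc_zero : homogeneous_continuous (fun=> 0 : R) (n := n).
Proof. by split=> [|a t _]; [exact: cst_continuous|rewrite mulr0]. Qed.

Lemma hc_coord k : homogeneous_continuous (fun t => t ord0 k).
Proof. by split=> [|a t _]; [exact: coord_continuous|rewrite mxE]. Qed.

Lemma hc_lin a f g : homogeneous_continuous f -> homogeneous_continuous g ->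
  homogeneous_continuous (fun t => a * f t + g t).
Proof.
move=> [cf hf] [cg hg]; split=> [t|b t b0]; last by rewrite hf// hg//; ring.
apply: (@continuousD _ _ _ (fun t => a * f t) g) => //; last exact: cg.
by apply: continuousM; [exact: cst_continuous|exact: cf].
Qed.

Lemma hc_max f g : homogeneous_continuous f -> homogeneous_continuous g ->
  homogeneous_continuous (fun t => Num.max (f t) (g t)).
Proof.
move=> [cf hf] [cg hg]; split=> [t|b t b0]; last by rewrite hf// hg// maxr_pMr.
by apply: (continuous_max (f := f) (g := g)); [exact: cf|exact: cg].
Qed.

Lemma hc_min f g : homogeneous_continuous f -> homogeneous_continuous g ->
  homogeneous_continuous (fun t => Num.min (f t) (g t)).
Proof.
move=> [cf hf] [cg hg]; split=> [t|b t b0]; last by rewrite hf// hg// minr_pMr.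
by apply: (continuous_min (f := f) (g := g)); [exact: cf|exact: cg].
Qed.

Lemma ll_hc g : lattice_linear g -> homogeneous_continuous g.
Proof.
elim=> [|k|a f g' _ ? _ ?|f g' _ ? _ ?|f g' _ ? _ ?];
  [exact: hc_zero|exact: hc_coord|exact: hc_lin|exact: hc_max|exact: hc_min].
Qed.

Lemma ll_scale a f : lattice_linear f -> lattice_linear (fun t => a * f t).
Proof.
move=> lf; have := ll_lin a lf ll_zero.
by congr lattice_linear; apply/funext => t; rewrite addr0.
Qed.

Lemma ll_add f g : lattice_linear f -> lattice_linear g ->
  lattice_linear (fun t => f t + g t).
Proof.
move=> lf lg; have := ll_lin 1 lf lg.
by congr lattice_linear; apply/funext => t; rewrite mul1r.
Qed.

Lemma ll_norm f : lattice_linear f -> lattice_linear (fun t => `|f t|).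
Proof.
move=> lf; have := ll_max lf (ll_scale (-1) lf).
by congr lattice_linear; apply/funext => t; rewrite mulN1r maxC maxNr.
Qed.

Lemma ll_sum (I : Type) (r : seq I) (F : I -> 'rV[R]_n -> R) :
  (forall i, lattice_linear (F i)) -> lattice_linear (fun t => \sum_(i <- r) F i t).
Proof.
move=> lF; elim: r => [|i r ih].
  by have := ll_zero; congr lattice_linear; apply/funext => t; rewrite big_nil.
have := ll_add (lF i) ih.
by congr lattice_linear; apply/funext => t; rewrite big_cons.
Qed.

Definition l1norm t : R := \sum_(k < n) `|t ord0 k|.

Lemma ll_l1norm : lattice_linear l1norm.
Proof. by apply: ll_sum => k; apply/ll_norm/ll_coord. Qed.

Lemma l1norm_ge0 t : 0 <= l1norm t.
Proof. exact: sumr_ge0. Qed.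

Lemma l1norm_ge_coord t k : `|t ord0 k| <= l1norm t.
Proof. by rewrite /l1norm (bigD1 k)//= lerDl sumr_ge0. Qed.

Lemma mx_norm_le_l1norm t : `|t| <= l1norm t.
Proof.
rewrite [leLHS]/Num.norm/= mx_normrE; apply/bigmax_leP; split; first exact: l1norm_ge0.
by move=> [i j] _ /=; rewrite (ord1 i) l1norm_ge_coord.
Qed.

Lemma l1norm_eq0 t : l1norm t = 0 -> t = 0.
Proof.
move=> t0; apply/rowP => k; rewrite mxE; apply/eqP.
by rewrite -normr_le0 -t0 l1norm_ge_coord.
Qed.

Lemma l1normZ a t : 0 <= a -> l1norm (a *: t) = a * l1norm t.
Proof. by move: a t; have [_] := ll_hc ll_l1norm. Qed.

Definition l1sphere : set 'rV[R]_n := [set t | l1norm t = 1].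

Lemma l1sphere_compact : compact l1sphere.
Proof.
apply: bounded_closed_compact.
  exists 1; split=> [|M M1 t /= t1]; first exact: num_real.
  by rewrite (le_trans (mx_norm_le_l1norm t))// t1 ltW.
have [/continuous_closedP/(_ [set 1])] := ll_hc ll_l1norm.
by move=> h _; apply: h; exact: closed_eq.
Qed.

(** All terms are positively homogeneous of degree one. *)
Lemma l1sphere_suffices f g (eps : R) :
  homogeneous_continuous f -> homogeneous_continuous g ->
  (forall t, l1sphere t -> `|f t - g t| <= eps) ->
  forall t, `|f t - g t| <= eps * l1norm t.
Proof.
move=> [_ hf] [_ hg] fg t.
have [t0|t0] := eqVneq (l1norm t) 0.
  rewrite t0 mulr0 (l1norm_eq0 t0) -(scale0r 0) hf// hg// !mul0r subrr normr0//.
have tp : 0 < l1norm t by rewrite lt_def t0 l1norm_ge0.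
have t_ge0 := ltW tp.
have -> : t = l1norm t *: ((l1norm t)^-1 *: t) by rewrite scalerA mulfV// scale1r.
set s := _^-1 *: t.
have s1 : l1norm s = 1 by rewrite l1normZ ?invr_ge0// mulVf.
rewrite hf// hg// l1normZ// s1 mulr1 -mulrBr normrM gtr0_norm//.
by rewrite [leRHS]mulrC ler_pM2l// fg.
Qed.

(** On the sphere this is [h s] minus [K] times the distance to [s]; the other
    factors [l1norm t] make it homogeneous. *)
Definition tent h K s t : R := h s * l1norm t - K * l1norm (t - l1norm t *: s).

Lemma ll_tent h K s : lattice_linear (tent h K s).
Proof.
have lt k : lattice_linear (fun t => t ord0 k + - s ord0 k * l1norm t).
  by apply: ll_add; [exact: ll_coord|exact/ll_scale/ll_l1norm].
have ld : lattice_linear (fun t => l1norm (t - l1norm t *: s)).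
  have := ll_sum (index_enum 'I_n) (fun k => ll_norm (lt k)).
  congr lattice_linear; apply/funext => t; apply: eq_bigr => k _.
  by rewrite !mxE; congr (`|_|); ring.
have := ll_lin (h s) ll_l1norm (ll_scale (- K) ld).
by congr lattice_linear; apply/funext => t; rewrite mulNr.
Qed.

(** A lattice version of the Stone-Weierstrass theorem, with an explicit family.  A
    tent steep enough stays below [h + eps] on the sphere, and exceeds [h - eps]
    near its summit.  By compactness, at every point one of finitely many
    tents exceeds [h - eps], and their maximum is [g]. *)
Theorem lattice_linear_dense h (eps : R) : homogeneous_continuous h -> 0 < eps ->
  exists2 g, lattice_linear g & forall t, `|h t - g t| <= eps * l1norm t.
Proof.
move=> hh eps0; have [ch _] := hh.
suff [g lg hg] : exists2 g, lattice_linear g &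
    forall t, l1sphere t -> `|h t - g t| <= eps.
  by exists g => //; apply: l1sphere_suffices => //; exact: ll_hc.
have [[s0 Ss0]|S0] := pselect (l1sphere !=set0); last first.
  by exists (fun=> 0); [exact: ll_zero|move=> t St; case: S0; exists t].
have [B hB] : exists B, forall t, l1sphere t -> `|h t| <= B.
  have [||c _ hc] := @EVT_max_rV R n (fun t => `|h t|) l1sphere _ l1sphere_compact.
  - by exists s0.
  - apply: continuous_subspaceT => t; apply: continuous_comp; first exact: ch.
    exact: norm_continuous.
  - by exists `|h c| => t St; apply: hc; rewrite inE.
have B0 : 0 <= B := le_trans (normr_ge0 _) (hB _ Ss0).
have tentS K s : l1sphere s -> tent h K s s = h s.
  have l10 : l1norm 0 = 0 by rewrite -(scale0r 0) l1normZ// mul0r.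
  by move=> s1; rewrite /tent s1 scale1r subrr mulr1 l10 mulr0 subr0.
have /choice[K hK] : forall s, exists K, l1sphere s ->
    forall t, l1sphere t -> tent h K s t <= h t + eps.
  move=> s; have [Ss|nSs] := pselect (l1sphere s); last by exists 0.
  have /cvgrPdist_lt/(_ eps eps0)/nbhs_ballP[d /= d0 hd] := ch s.
  (* At distance [d] or more the tent has lost [2 * B], which bounds the oscillation of [h]. *)
  exists (2 * B / d) => _ t t1; rewrite /tent t1 scale1r mulr1.
  have [dt|dt] := ltP (l1norm (t - s)) d.
    have := hd t; rewrite -ball_normE/= => /(_ _)/wrap[].
      by rewrite distrC (le_lt_trans (mx_norm_le_l1norm _)).
    rewrite ltr_norml => /andP[_ h1].
    have Bd : 0 <= 2 * B / d by apply: divr_ge0; [exact: mulr_ge0|exact: ltW].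
    by have := mulr_ge0 Bd (l1norm_ge0 (t - s)); lra.
  have : 2 * B <= 2 * B / d * l1norm (t - s).
    by rewrite mulrAC ler_pdivlMr// ler_wpM2l// mulr_ge0.
  have := hB _ Ss; have := hB _ t1; rewrite !ler_norml => /andP[+ _] /andP[_].
  by lra.
pose U s := [set t | h t - eps < tent h (K s) s t].
have oU s : open (U s).
  have ct : continuous (fun t => -1 * h t + tent h (K s) s t).
    by have [] := hc_lin (-1) hh (ll_hc (ll_tent h (K s) s)).
  have -> : U s = (fun t => -1 * h t + tent h (K s) s t) @^-1` [set x | - eps < x].
    by apply/seteqP; split=> t /=; rewrite /U/=; lra.
  by move/continuousP : ct; apply; exact: open_gt.
have := l1sphere_compact; rewrite compact_cover.
move=> /(_ _ l1sphere U (fun s _ => oU s))[|D DS SD].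
  by move=> s Ss; exists s => //; rewrite /U/= tentS//; lra.
have H (r : seq 'rV[R]_n) : (forall s, s \in r -> l1sphere s) ->
    exists2 g, lattice_linear g & forall t, l1sphere t -> g t <= h t + eps /\
      forall s, s \in r -> tent h (K s) s t <= g t.
  elim: r => [_|s r ih rS].
    exists (tent h (K s0) s0); first exact: ll_tent.
    by move=> t St; split=> //; exact: hK.
  have [x xr|g lg hg] := ih; first by apply: rS; rewrite inE xr orbT.
  exists (fun t => Num.max (tent h (K s) s t) (g t)).
    by apply: ll_max => //; exact: ll_tent.
  move=> t St; have [gt rt] := hg _ St; split.
    by rewrite ge_max gt hK//; apply: rS; rewrite mem_head.
  move=> x; rewrite inE => /orP[/eqP->|/rt xt]; rewrite le_max ?lexx//.
  by rewrite xt orbT.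
have [|g lg hg] := H (finmap.enum_fset D); first by move=> s /DS; rewrite inE.
exists g => // t St; have [gt rt] := hg _ St.
have [s /= sD] := SD _ St; rewrite /U/= => st.
by have := rt _ sD; rewrite ler_norml; lra.
Qed.

End LatticeLinear.

Section PowerSums.
Variables (R : realType) (p : R).
Hypothesis p_gt0 : 0 < p.

Lemma powRK (x : R) : 0 <= x -> (x `^ p) `^ p^-1 = x.
Proof. by move=> x0; rewrite -powRrM mulfV ?gt_eqF// powRr1. Qed.

Lemma powRVK (x : R) : 0 <= x -> (x `^ p^-1) `^ p = x.
Proof. by move=> x0; rewrite -powRrM mulVf ?gt_eqF// powRr1. Qed.

Lemma powR_lt_exists (eps : R) : 0 < eps ->
  exists2 d : R, 0 < d & forall x, 0 <= x < d -> x `^ p < eps.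
Proof.
move=> eps0; exists (eps `^ p^-1); first exact: powR_gt0.
move=> x /andP[x0 xd]; rewrite -[ltRHS]powRVK ?ltW//.
by apply: gt0_ltr_powR => //; rewrite nnegrE ?powR_ge0.
Qed.

End PowerSums.

Lemma continuous_norm_powR (R : realType) (p : R) : 0 < p -> continuous (fun x : R => `|x| `^ p).
Proof.
move=> p0 x; have [->|x0] := eqVneq x 0.
  apply/cvgrPdist_lt => eps eps0; have [d d0 hd] := powR_lt_exists p0 eps0.
  apply/nbhs_ballP; exists d => //= y; rewrite /ball/= sub0r normrN => yd.
  rewrite normr0 powR0 ?gt_eqF// sub0r normrN ger0_norm ?powR_ge0// hd//.
  by rewrite normr_ge0.
apply: (@continuous_comp _ _ _ (fun x : R => `|x|) (fun y => y `^ p)).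
  exact: norm_continuous.
apply: differentiable_continuous; apply/derivable1_diffP.
by apply: derivable_powR; rewrite in_itv/= andbT normr_gt0.
Qed.

Lemma hc_power_sum (R : realType) (p : R) n : 0 < p ->
  homogeneous_continuous (fun t : 'rV[R]_n => (\sum_(k < n) `|t ord0 k| `^ p) `^ p^-1).
Proof.
move=> p0; split=> [|a t a0].
  have -> : (fun t : 'rV[R]_n => (\sum_(k < n) `|t ord0 k| `^ p) `^ p^-1) =
      (fun y => `|y| `^ p^-1) \o (fun t : 'rV[R]_n => \sum_(k < n) `|t ord0 k| `^ p).
    apply/funext => t /=; rewrite [X in _ = X `^ _]ger0_norm//.
    by apply: sumr_ge0 => k _; exact: powR_ge0.
  move=> t; apply: continuous_comp; last first.
    by apply: continuous_norm_powR; rewrite invr_gt0.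
  suff H (r : seq 'I_n) : continuous (fun t : 'rV[R]_n => \sum_(k <- r) `|t ord0 k| `^ p).
    exact: H.
  elim: r => [|k r ih].
    have -> : (fun t : 'rV[R]_n => \sum_(k <- [::]) `|t ord0 k| `^ p) = fun=> 0.
      by apply/funext => u; rewrite big_nil.
    exact: cst_continuous.
  have -> : (fun t : 'rV[R]_n => \sum_(k <- k :: r) `|t ord0 k| `^ p) =
      (fun t => `|t ord0 k| `^ p + \sum_(k <- r) `|t ord0 k| `^ p).
    by apply/funext => u; rewrite big_cons.
  move=> u; apply: (@continuousD _ _ _ (fun t : 'rV[R]_n => `|t ord0 k| `^ p)); last exact: ih.
  apply: (@continuous_comp _ _ _ (fun t : 'rV[R]_n => t ord0 k) (fun y => `|y| `^ p)).
    exact: coord_continuous.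
  exact: continuous_norm_powR.
have -> : \sum_(k < n) `|(a *: t) ord0 k| `^ p = a `^ p * \sum_(k < n) `|t ord0 k| `^ p.
  rewrite mulr_sumr; apply: eq_bigr => k _.
  by rewrite mxE normrM powRM// ger0_norm.
by rewrite powRM ?powR_ge0 ?powRK//; apply: sumr_ge0 => k _; exact: powR_ge0.
Qed.

(** * Functional calculus on the free lattice, and domination *)

Section PNorm.
Variables (R : realType) (p : R) (E : lmodType R) (N : E -> R).
Hypotheses (p_gt0 : 0 < p) (pN : p_norm p N).

(** The subadditive power of a p-norm. *)
Definition ppow (x : E) : R := N x `^ p.

Lemma pnorm_ge0 x : 0 <= N x. Proof. by case: pN. Qed.

Lemma ppow_ge0 x : 0 <= ppow x. Proof. exact: powR_ge0. Qed.

Lemma ppowZ a x : ppow (a *: x) = `|a| `^ p * ppow x.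
Proof. by case: pN => N0 _ NZ _; rewrite /ppow NZ powRM. Qed.

Lemma ppow0 : ppow 0 = 0.
Proof. by rewrite -(scale0r 0) ppowZ normr0 powR0 ?gt_eqF// mul0r. Qed.

Lemma ppowN x : ppow (- x) = ppow x.
Proof. by rewrite -scaleN1r ppowZ normrN1 powR1 mul1r. Qed.

Lemma ppowB x y : ppow (x - y) = ppow (y - x).
Proof. by rewrite -ppowN opprB. Qed.

Lemma ppowD x y : ppow (x + y) <= ppow x + ppow y.
Proof. by case: pN => _ _ _; apply. Qed.

Lemma ppow_eq0 x : ppow x = 0 -> x = 0.
Proof. by case: pN => _ N0 _ _ /powR_eq0_eq0; exact: N0. Qed.

Lemma ppow_gt0 x : x != 0 -> 0 < ppow x.
Proof.
by move=> x0; rewrite lt_def ppow_ge0 andbT; apply: contra_neq x0; exact: ppow_eq0.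
Qed.

Lemma ppowB_le x y z : ppow (x - z) <= ppow (x - y) + ppow (y - z).
Proof. by have := ppowD (x - y) (y - z); rewrite addrA subrK. Qed.

Lemma pnorm_ppow_lt x (eps : R) : 0 < eps -> (ppow x < eps `^ p) = (N x < eps).
Proof.
move=> e0; have := pnorm_ge0 x => N0; apply/idP/idP => [|h].
  by apply: contraTT; rewrite -!leNgt => h; apply: ge0_ler_powR => //;
    rewrite ?nnegrE ltW.
by apply: gt0_ltr_powR => //; rewrite nnegrE// ltW.
Qed.

Lemma pnorm_complete : norm_complete N <-> forall u : nat -> E,
  (forall eps : R, 0 < eps -> exists K : nat, forall m n : nat,
     (K <= m)%N -> (K <= n)%N -> ppow (u m - u n) < eps) ->
  exists l : E, forall eps : R, 0 < eps -> exists K : nat,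
    forall n : nat, (K <= n)%N -> ppow (u n - l) < eps.
Proof.
split=> cN u cu.
  have [|l ul] := cN u.
    move=> eps eps0; have [K hK] := cu _ (powR_gt0 p eps0).
    by exists K => m n Km Kn; rewrite -pnorm_ppow_lt// hK.
  exists l => eps eps0.
  have [K hK] := ul _ (powR_gt0 p^-1 eps0).
  exists K => n Kn; rewrite -[ltRHS](powRVK p_gt0) ?ltW//.
  by rewrite pnorm_ppow_lt ?powR_gt0// hK.
have [|l ul] := cN u.
  move=> eps eps0; have [K hK] := cu _ (powR_gt0 p^-1 eps0).
  exists K => m n Km Kn; rewrite -[ltRHS](powRVK p_gt0) ?ltW//.
  by rewrite pnorm_ppow_lt ?powR_gt0// hK.
exists l => eps eps0; have [K hK] := ul _ (powR_gt0 p eps0).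
by exists K => n Kn; rewrite -pnorm_ppow_lt// hK.
Qed.

End PNorm.

Section SmallBound.
Variables (R : realType) (p : R).
Hypothesis p_gt0 : 0 < p.

Lemma powR_le_exists (a b eps : R) : 0 <= a -> 0 <= b -> 0 < eps ->
  exists2 d : R, 0 < d & a * d + d `^ p * b <= eps.
Proof.
move=> a0 b0 eps0.
have [|d d0 hd] := powR_lt_exists p_gt0 (eps := eps / (2 * (b + 1))).
  by rewrite divr_gt0// mulr_gt0// ltr_wpDl.
pose t := Num.min (d / 2) (eps / (2 * (a + 1))).
have t0 : 0 < t by rewrite lt_min !divr_gt0// mulr_gt0// ltr_wpDl.
exists t => //.
have t2 : t <= eps / (2 * (a + 1)) by rewrite ge_min lexx orbT.
have td : t < d.
  by rewrite (@le_lt_trans _ _ (d / 2))// ?ge_min ?lexx// ltr_pdivrMr//; lra.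
have tp := hd t; move: tp; rewrite ltW//= => /(_ td) tp.
have a1 : a * t <= eps / 2.
  apply: (@le_trans _ _ ((a + 1) * t)); first by rewrite ler_wpM2r ?ltW//; lra.
  have -> : eps / 2 = (a + 1) * (eps / (2 * (a + 1))) by field; lra.
  by rewrite ler_wpM2l//; lra.
have b1 : t `^ p * b <= eps / 2.
  have -> : eps / 2 = eps / (2 * (b + 1)) * (b + 1) by field; lra.
  by apply: ler_pM => //; [exact: powR_ge0|exact: ltW|lra].
lra.
Qed.

Lemma small_le (x y a b : R) : 0 <= a -> 0 <= b ->
  (forall d : R, 0 < d -> x <= y + a * d + d `^ p * b) -> x <= y.
Proof.
move=> a0 b0 h; apply/ler_addgt0Pr => eps eps0.
have [d d0 hd] := powR_le_exists a0 b0 eps0.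
by have := h d d0; lra.
Qed.

End SmallBound.

Lemma norm_max_sub (R : realDomainType) (a b c d : R) :
  `|Num.max a b - Num.max c d| <= `|a - c| + `|b - d|.
Proof.
have [ab|ab] := lerP a b; have [cd|cd] := lerP c d;
  have := ler_norm (a - c); have := ler_norm (c - a);
  have := ler_norm (b - d); have := ler_norm (d - b);
  rewrite (distrC d b) (distrC c a) ler_norml; lra.
Qed.

Lemma norm_min_sub (R : realDomainType) (a b c d : R) :
  `|Num.min a b - Num.min c d| <= `|a - c| + `|b - d|.
Proof.
have [ab|ab] := lerP a b; have [cd|cd] := lerP c d;
  have := ler_norm (a - c); have := ler_norm (c - a);
  have := ler_norm (b - d); have := ler_norm (d - b);
  rewrite (distrC d b) (distrC c a) ler_norml; lra.
Qed.

Section LatticePNorm.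
Variables (R : realType) (p : R) (X : vectorLatticeType R) (N : X -> R).
Hypotheses (p_gt0 : 0 < p) (pN : p_norm p N) (lN : lattice_norm N).
Local Notation M := (ppow p N).

Lemma ppow_le x y : vabs x <= vabs y -> M x <= M y.
Proof.
move=> /lN h; apply: ge0_ler_powR; rewrite ?nnegrE ?(pnorm_ge0 pN)//.
exact: ltW.
Qed.

Lemma ppow_abs x : M (vabs x) = M x.
Proof. by apply/le_anti; rewrite !ppow_le// vabs_id. Qed.

Lemma ppow_le2 x y z : vabs x <= vabs y + vabs z -> M x <= M y + M z.
Proof.
move=> h; rewrite -(ppow_abs y) -(ppow_abs z); apply: le_trans (ppowD pN _ _).
apply: ppow_le; rewrite [leRHS]ger0_vabs//.
by apply: vaddr_ge0; exact: vabs_ge0.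
Qed.

Lemma ppow_join x y x' y' : M (vjoin x y - vjoin x' y') <= M (x - x') + M (y - y').
Proof. by apply: ppow_le2; exact: vabs_join. Qed.

Lemma ppow_meet x y x' y' : M (vmeet x y - vmeet x' y') <= M (x - x') + M (y - y').
Proof. by apply: ppow_le2; exact: vabs_meet. Qed.

End LatticePNorm.

Section FunctionalCalculus.
Variables (R : realType) (p : R) (E : lmodType R).
Variables (V F : vectorLatticeType R) (iota : {linear E -> V}) (j : {linear V -> F}).
Variables (hat : {linear V -> fnlat R {scalar E}}) (NF : F -> R).
Hypothesis p_gt0 : 0 < p.
Hypotheses (V_free : is_FVL iota) (hom_j : lattice_hom j).
Hypotheses (hom_hat : lattice_hom hat).
Hypothesis hatE : forall e phi, hat (iota e) phi = phi e.
Hypotheses (pF : p_norm p NF) (cF : norm_complete NF) (lF : lattice_norm NF).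
Local Notation M := (ppow p NF).

Section Point.
Variables (n : nat) (e : 'I_n -> E).
Implicit Types (f g h : 'rV[R]_n -> R) (v w : V) (z : F) (eta : R).

Definition values (phi : {scalar E}) : 'rV[R]_n := \row_k phi (e k).

(** The unit relative to which errors are measured: its value at a functional is the
    l1 norm of the point [values]. *)
Definition control : V := \sum_(k < n) vabs (iota (e k)).

Lemma hat_abs v phi : hat (vabs v) phi = `|hat v phi|.
Proof. by rewrite hom_abs// fn_absE. Qed.

Lemma hat_control phi : hat control phi = l1norm (values phi).
Proof.
rewrite /control /l1norm; under [RHS]eq_bigr do rewrite mxE -hatE -hat_abs.
elim: (index_enum _) => [|k r ih]; first by rewrite !big_nil linear0.
by rewrite !big_cons linearD -ih.
Qed.

Definition represents h eta v := forall phi,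
  `|hat v phi - h (values phi)| <= eta * l1norm (values phi).

Lemma lattice_linear_represented g : lattice_linear g ->
  exists v, forall phi, hat v phi = g (values phi).
Proof.
elim=> [|k|a f f' _ [v vE] _ [w wE]|f f' _ [v vE] _ [w wE]|f f' _ [v vE] _ [w wE]].
- by exists 0 => phi; rewrite linear0.
- by exists (iota (e k)) => phi; rewrite hatE mxE.
- by exists (a *: v + w) => phi; rewrite linearP -vE -wE.
- by exists (vjoin v w) => phi; rewrite hom_join// -vE -wE.
- by exists (vmeet v w) => phi; rewrite hom_meet// -vE -wE.
Qed.

Lemma represents_exists h eta : homogeneous_continuous h -> 0 < eta ->
  exists v, represents h eta v.
Proof.
move=> hh eta0; have [g lg hg] := lattice_linear_dense hh eta0.
have [v vE] := lattice_linear_represented lg.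
by exists v => phi; rewrite vE distrC.
Qed.

(** The pointwise order of the free vector lattice transfers estimates on functions
    to [F]. *)
Lemma represents_close h eta eta' v w : 0 <= eta + eta' ->
  represents h eta v -> represents h eta' w ->
  M (j v - j w) <= (eta + eta') `^ p * M (j control).
Proof.
move=> eta0 hv hw; rewrite -[X in X `^ p]ger0_norm// -ppowZ// -linearB -linearZ/=.
apply: ppow_le => //; rewrite -!(hom_abs hom_j); apply: hom_le => //.
apply: (FVL_le_pointwise V_free hom_hat hatE) => phi.
rewrite !hat_abs linearB linearZ /=.
change (`|hat v phi - hat w phi| <= `|(eta + eta') * hat control phi|).
rewrite hat_control [leRHS]ger0_norm; last by rewrite mulr_ge0 ?l1norm_ge0.
have -> : hat v phi - hat w phi =
    (hat v phi - h (values phi)) - (hat w phi - h (values phi)) by ring.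
by rewrite (le_trans (ler_normB _ _))// mulrDl lerD.
Qed.

(** Elements of [V] play the role of formal lattice-linear expressions in the [e k].
    Approximating [h] only at the points [values phi] allows linear relations
    between the [e k]. *)
Definition calculus_value h z := forall eta, 0 < eta ->
  exists2 v, represents h eta v & M (z - j v) <= eta.

Lemma calculus_value_unique h z (w : F) :
  calculus_value h z -> calculus_value h w -> z = w.
Proof.
move=> hz hw; apply/subr0_eq/(ppow_eq0 pF)/le_anti; rewrite ppow_ge0 andbT.
apply: (small_le p_gt0 (a := 1) (b := M (j control))) => //.
  exact: powR_ge0.
move=> d d0; have d2 : 0 < d / 2 by rewrite divr_gt0.
have [v vh vz] := hz _ d2; have [v' vh' vw] := hw _ d2.
have d22 : d / 2 + d / 2 = d by lra.
have := represents_close _ vh vh'; rewrite d22 => /(_ (ltW d0)) vv.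
have h1 := ppowB_le pF z (j v) w.
have h2 := ppowB_le pF (j v) (j v') w.
rewrite (ppowB pF w) in vw.
by lra.
Qed.

Lemma calculus_value_exists h : homogeneous_continuous h -> exists z, calculus_value h z.
Proof.
move=> hh; pose c m : R := m.+1%:R^-1.
have c0 m : 0 < c m by rewrite invr_gt0 ltr0Sn.
have c_small (eps : R) : 0 < eps -> exists K : nat, forall m, (K <= m)%N -> c m <= eps.
  move=> eps0; exists (Num.truncn eps^-1) => m Km.
  rewrite /c invf_ple ?posrE ?ltr0Sn//.
  rewrite (le_trans (ltW (truncnS_gt _)))// ler_nat ltnS.
  done.
have /choice[v hv] : forall m, exists v, represents h (c m) v.
  by move=> m; exact: represents_exists.
have [|z hz] := (pnorm_complete p_gt0 pF).1 cF (fun m => j (v m)).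
  move=> eps eps0.
  have [d d0 hd] := powR_le_exists p_gt0 (lexx 0) (ppow_ge0 p NF (j control)) 
    (divr_gt0 eps0 (ltr0Sn R 1)).
  have [K hK] := c_small (d / 2) (divr_gt0 d0 (ltr0Sn R 1)).
  exists K => k m Kk Km.
  have ckm : c k + c m <= d by have := hK _ Kk; have := hK _ Km; lra.
  apply: (le_lt_trans (represents_close _ (hv k) (hv m))).
    by rewrite addr_ge0// ltW.
  apply: (@le_lt_trans _ _ (d `^ p * M (j control))); last by lra.
  rewrite ler_wpM2r ?ppow_ge0// ge0_ler_powR ?nnegrE// ltW// addr_gt0//.
exists z => eta eta0; have [K1 h1] := c_small _ eta0; have [K2 h2] := hz _ eta0.
exists (v (maxn K1 K2)).
  move=> phi; apply: le_trans (hv _ phi) _.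
  by rewrite ler_wpM2r ?l1norm_ge0// h1// leq_maxl.
by rewrite (ppowB pF) ltW// h2// leq_maxr.
Qed.

Lemma calculus_value_lin (a : R) f g z (w : F) :
  calculus_value f z -> calculus_value g w ->
  calculus_value (fun t => a * f t + g t) (a *: z + w).
Proof.
move=> fz gw eta eta0; pose b := `|a| + `|a| `^ p + 1.
have a0 := normr_ge0 a; have ap0 := powR_ge0 `|a| p.
have b0 : 0 < b by rewrite /b; lra.
have [v vf vz] := fz _ (divr_gt0 eta0 b0); have [v' vg vw] := gw _ (divr_gt0 eta0 b0).
set d := eta / b in vf vz vg vw; have d0 : 0 <= d by rewrite divr_ge0// ltW.
have db : eta = d * b by rewrite /d; field; rewrite gt_eqF.
exists (a *: v + v').
  move=> phi; rewrite linearP.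
  change (`|a * hat v phi + hat v' phi - (a * f (values phi) + g (values phi))|
    <= eta * l1norm (values phi)).
  have -> : a * hat v phi + hat v' phi - (a * f (values phi) + g (values phi)) =
     a * (hat v phi - f (values phi)) + (hat v' phi - g (values phi)) by ring.
  apply: (le_trans (ler_normD _ _)); rewrite normrM.
  have h1 := ler_wpM2l a0 (vf phi); have h2 := vg phi.
  have h3 := mulr_ge0 ap0 (mulr_ge0 d0 (l1norm_ge0 (values phi))).
  by rewrite db /b; nra.
have -> : a *: z + w - j (a *: v + v') = a *: (z - j v) + (w - j v').
  by rewrite linearP scalerBr opprD addrACA.
apply: (le_trans (ppowD pF _ _)); rewrite ppowZ//.
have := ler_wpM2l ap0 vz; have := mulr_ge0 a0 d0.
by rewrite db /b; nra.
Qed.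

Lemma calculus_value_max f g z (w : F) :
  calculus_value f z -> calculus_value g w ->
  calculus_value (fun t => Num.max (f t) (g t)) (vjoin z w).
Proof.
move=> fz gw eta eta0; have e2 : 0 < eta / 2 by lra.
have [v vf vz] := fz _ e2; have [v' vg vw] := gw _ e2.
exists (vjoin v v'); last first.
  by rewrite hom_join// (le_trans (ppow_join _ _ _ _ _ _ _))//; lra.
move=> phi; rewrite hom_join//.
apply: (le_trans (norm_max_sub _ _ _ _)).
by have := vf phi; have := vg phi; lra.
Qed.

Lemma calculus_value_min f g z (w : F) :
  calculus_value f z -> calculus_value g w ->
  calculus_value (fun t => Num.min (f t) (g t)) (vmeet z w).
Proof.
move=> fz gw eta eta0; have e2 : 0 < eta / 2 by lra.
have [v vf vz] := fz _ e2; have [v' vg vw] := gw _ e2.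
exists (vmeet v v'); last first.
  by rewrite hom_meet// (le_trans (ppow_meet _ _ _ _ _ _ _))//; lra.
move=> phi; rewrite hom_meet//.
apply: (le_trans (norm_min_sub _ _ _ _)).
by have := vf phi; have := vg phi; lra.
Qed.

Definition calculus h : F := xget 0 (calculus_value h).

Lemma calculusP h : homogeneous_continuous h -> calculus_value h (calculus h).
Proof. by move=> /calculus_value_exists hz; exact: xgetPex. Qed.

Lemma calculusE h z : calculus_value h z -> calculus h = z.
Proof.
by move=> hz; apply: (@calculus_value_unique h) => //; apply: xgetPex; exists z.
Qed.

Lemma calculus_Krivine : Krivine_calculus (fun k => j (iota (e k))) calculus.
Proof.
split=> [k|f g hf hg].
  apply: calculusE => eta eta0; exists (iota (e k)).
    by move=> phi; rewrite hatE mxE subrr normr0 mulr_ge0 ?l1norm_ge0// ltW.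
  by rewrite subrr ppow0// ltW.
have cf := calculusP hf; have cg := calculusP hg.
split=> [a||]; apply: calculusE; [exact: calculus_value_lin| |].
  exact: (calculus_value_max cf cg).
exact: (calculus_value_min cf cg).
Qed.

End Point.

(** Let [z] be the p-sum of the [j (iota x)], for [x] in [s].  The elements of [V] that
    represent this p-sum dominate [vabs (iota a)] up to a small multiple of
    [control], at every functional by hypothesis, hence in [V].  So [z] dominates
    the image of [a] up to small errors, and p-convexity bounds the norm of [z]. *)
Theorem domination : p_convex p NF ->
  exists2 C : R, 0 < C & forall (a : E) (s : seq E),
    (forall phi : {scalar E}, `|phi a| `^ p <= \sum_(x <- s) `|phi x| `^ p) ->
    M (j (iota a)) <= C * \sum_(x <- s) M (j (iota x)).
Proof.
move=> [C [C0 hC]]; exists (C `^ p); first exact: powR_gt0.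
move=> a s dom; pose e (k : 'I_(size s)) := nth 0 s k.
have sumE (f : E -> R) : \sum_(x <- s) f x = \sum_(k < size s) f (e k).
  by rewrite (big_nth 0) big_mkord.
pose h (t : 'rV[R]_(size s)) := (\sum_k `|t ord0 k| `^ p) `^ p^-1.
have hh : homogeneous_continuous h by exact: hc_power_sum.
have := hC _ (fun k => j (iota (e k))) (calculus e h).
move=> /(_ (ex_intro2 _ _ _ (calculus_Krivine e) erefl)) Nz.
have Sge0 : 0 <= \sum_(k < size s) NF (j (iota (e k))) `^ p.
  by apply: sumr_ge0 => k _; exact: powR_ge0.
apply: (@le_trans _ _ (M (calculus e h))); last first.
  rewrite sumE -[X in _ <= _ * X](powRVK p_gt0)// -powRM ?powR_ge0 ?(ltW C0)//.
  apply: ge0_ler_powR; rewrite ?nnegrE ?(pnorm_ge0 pF) ?(ltW p_gt0)//.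
  by rewrite mulr_ge0 ?powR_ge0 ?(ltW C0).
apply: (small_le p_gt0 (a := 1) (b := M (j (control e)))) => //.
  exact: powR_ge0.
move=> d d0; have [v vh vz] := calculusP e hh d0.
have av : vabs (iota a) <= v + d *: control e.
  apply: (FVL_le_pointwise V_free hom_hat hatE) => phi.
  rewrite hat_abs hatE linearD linearZ /=.
  change (`|phi a| <= hat v phi + d * hat (control e) phi).
  rewrite hat_control; have := vh phi; rewrite ler_norml => /andP[+ _].
  suff : `|phi a| <= h (values e phi) by lra.
  rewrite -[leLHS](powRK p_gt0)//; apply: ge0_ler_powR.
  - by rewrite invr_ge0 ltW.
  - by rewrite nnegrE powR_ge0.
  - by rewrite nnegrE; apply: sumr_ge0 => k _; exact: powR_ge0.
  apply: le_trans (dom phi) _; rewrite sumE.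
  by apply: ler_sum => k _; rewrite mxE.
have : M (j (iota a)) <= M (j v) + M (j (d *: control e)).
  apply: le_trans (ppowD pF _ _); rewrite -linearD; apply: ppow_le => //.
  apply: le_trans (vabs_ge _).
  by rewrite -hom_abs//; exact: hom_le.
rewrite linearZ/= ppowZ// gtr0_norm//.
have := ppowD pF (calculus e h) (j v - calculus e h).
by rewrite addrC subrK (ppowB pF); lra.
Qed.

End FunctionalCalculus.

(** * Functionals prescribed on a finite set and small elsewhere *)

(** Since [r <= r ^ p] on [0, 1], the shares [r] of the two terms in their sum have
    p-th powers that add up to at least [1]. *)
Lemma norm_powRD (R : realType) (p : R) : 0 < p -> p <= 1 ->
  forall x y : R, `|x + y| `^ p <= `|x| `^ p + `|y| `^ p.
Proof.
move=> p0 p1 x y; have [xy0|xy0] := eqVneq (`|x| + `|y|) 0.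
  apply: (@le_trans _ _ 0); last by rewrite addr_ge0 ?powR_ge0.
  have : `|x + y| <= 0 by rewrite -xy0 ler_normD.
  by rewrite normr_le0 => /eqP->; rewrite normr0 powR0 ?gt_eqF.
have s0 : 0 < `|x| + `|y| by rewrite lt_def xy0 addr_ge0.
have H (z : R) : 0 <= z -> z <= `|x| + `|y| ->
    z / (`|x| + `|y|) * (`|x| + `|y|) `^ p <= z `^ p.
  rewrite le_eqVlt => /orP[/eqP<-|z0] zs; first by rewrite !mul0r powR_ge0.
  have r1 : 0 < z / (`|x| + `|y|) <= 1 by rewrite divr_gt0//= ler_pdivrMr// mul1r.
  have -> : z `^ p = (z / (`|x| + `|y|)) `^ p * (`|x| + `|y|) `^ p.
    by rewrite -powRM ?divfK// ltW//; case/andP: r1.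
  by rewrite ler_wpM2r ?powR_ge0// ger1_powR.
have := lerD (H _ (normr_ge0 x) _) (H _ (normr_ge0 y) _).
rewrite lerDl lerDr !normr_ge0 => /(_ isT isT); apply: le_trans.
rewrite -mulrDl -mulrDl mulfV// mul1r.
by apply: ge0_ler_powR; rewrite ?nnegrE ?ler_normD// ltW.
Qed.

Section FiniteSpan.
Variables (R : realType) (p : R) (E : lmodType R) (NE : E -> R).
Hypotheses (p_gt0 : 0 < p) (p_le1 : p <= 1) (pE : p_norm p NE).
Local Notation M := (ppow p NE).
Implicit Types (a : seq E) (x y : E) (theta phi psi : {scalar E}).

(** Recursion on the list makes the addition of one vector a single step. *)
Fixpoint spanned a y : Prop :=
  if a is x :: a' then exists c : R, spanned a' (y - c *: x) else y = 0.

Lemma spannedP a (c : R) x y : spanned a x -> spanned a y -> spanned a (c *: x + y).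
Proof.
elim: a x y => [x y -> ->|z a ih x y [d dx] [d' dy]]; first by rewrite /= scaler0 addr0.
exists (c * d + d'); have := ih _ _ dx dy.
by rewrite scalerBr scalerDl scalerA opprD addrACA.
Qed.

Lemma spanned0 a : spanned a 0.
Proof. by elim: a => //= z a ih; exists 0; rewrite scale0r subr0. Qed.

Lemma spannedZ a (c : R) x : spanned a x -> spanned a (c *: x).
Proof. by move=> ax; rewrite -[_ *: _]addr0; exact/spannedP/spanned0. Qed.

Lemma spannedB a x y : spanned a x -> spanned a y -> spanned a (x - y).
Proof. by move=> ax ay; rewrite addrC -scaleN1r; exact: spannedP. Qed.

Lemma spanned_cons a x y : spanned a y -> spanned (x :: a) y.
Proof. by exists 0; rewrite scale0r subr0. Qed.

Definition pcauchy (u : nat -> E) := forall eps : R, 0 < eps -> exists K : nat,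
  forall m n : nat, (K <= m)%N -> (K <= n)%N -> M (u m - u n) < eps.

Definition pconv (u : nat -> E) l := forall eps : R, 0 < eps -> exists K : nat,
  forall n : nat, (K <= n)%N -> M (u n - l) < eps.

Definition span_complete a := forall u, (forall m, spanned a (u m)) -> pcauchy u ->
  exists2 l, spanned a l & pconv u l.

Lemma pconvD u v l k : pconv u l -> pconv v k -> pconv (fun m => u m + v m) (l + k).
Proof.
move=> ul vk eps eps0; have e2 : 0 < eps / 2 by lra.
have [K1 h1] := ul _ e2; have [K2 h2] := vk _ e2; exists (maxn K1 K2) => n.
rewrite geq_max => /andP[/h1 n1 /h2 n2].
by rewrite opprD addrACA (le_lt_trans (ppowD pE _ _))//; lra.
Qed.

Lemma pcauchyB u v : pcauchy u -> pcauchy v -> pcauchy (fun m => u m - v m).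
Proof.
move=> cu cv eps eps0; have e2 : 0 < eps / 2 by lra.
have [K1 h1] := cu _ e2; have [K2 h2] := cv _ e2; exists (maxn K1 K2) => m n.
rewrite !geq_max => /andP[m1 m2] /andP[n1 n2].
have -> : u m - v m - (u n - v n) = u m - u n - (v m - v n).
  by rewrite !opprD !opprK addrACA.
apply: (le_lt_trans (ppowD pE _ _)); rewrite ppowN//.
by have := h1 _ _ m1 n1; have := h2 _ _ m2 n2; lra.
Qed.

Lemma powR_norm_lt_exists (b eps : R) : 0 <= b -> 0 < eps ->
  exists2 d : R, 0 < d & forall c : R, `|c| < d -> `|c| `^ p * b < eps.
Proof.
move=> b0 eps0; have [|d d0 hd] := powR_lt_exists p_gt0 (eps := eps / (b + 1)).
  by rewrite divr_gt0// ltr_wpDl.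
exists d => // c cd; have := hd `|c|; rewrite normr_ge0 cd => /(_ isT) h.
have : `|c| `^ p * (b + 1) < eps by rewrite -ltr_pdivlMr// ltr_wpDl.
by have := powR_ge0 `|c| p; lra.
Qed.

(** The completeness of the scalars enters here.  It is indispensable for what
    follows: over the rationals, the coordinates on the span of [1] and [sqrt 2]
    inside the reals are unbounded functionals. *)
Lemma real_cauchy_conv (c : nat -> R) :
  (forall e : R, 0 < e -> exists K : nat, forall m n : nat,
     (K <= m)%N -> (K <= n)%N -> `|c m - c n| < e) ->
  exists d : R, forall e : R, 0 < e -> exists K : nat, forall n : nat,
    (K <= n)%N -> `|c n - d| < e.
Proof.
move=> cc; have /cvgrPdist_lt cd : cvg (c @ \oo).
  apply: cauchy_cvg; apply: cauchy_exP => e e0; have [K hK] := cc _ e0.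
  by exists (c K); exists K => // n /= Kn; exact: hK.
exists (lim (c @ \oo)) => e e0; have [K _ hK] := cd _ e0.
by exists K => n Kn; rewrite distrC; exact: hK.
Qed.

Definition separated a x := exists2 d : R, 0 < d &
  forall (c : R) y, spanned a y -> `|c| `^ p * d <= M (c *: x + y).

(** Otherwise vectors of the span would converge to [- x]. *)
Lemma span_complete_separated a x :
  span_complete a -> ~ spanned a x -> separated a x.
Proof.
move=> ca nax.
have [[d d0 hd]|nd] := pselect (exists2 d : R, 0 < d & forall y, spanned a y -> d <= M (x + y)).
  exists d => // c y ay; have [->|c0] := eqVneq c 0.
    by rewrite normr0 powR0 ?gt_eqF// mul0r ppow_ge0.
  have -> : c *: x + y = c *: (x + c^-1 *: y) by rewrite scalerDr scalerA mulfV// scale1r.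
  by rewrite ppowZ// ler_wpM2l ?powR_ge0// hd//; exact: spannedZ.
exfalso; apply: nax.
have /choice[y hy] : forall m : nat, exists y, spanned a y /\ M (x + y) < m.+1%:R^-1.
  move=> m; apply: contrapT => ny; apply: nd; exists m.+1%:R^-1.
    by rewrite invr_gt0 ltr0Sn.
  by move=> y ay; rewrite leNgt; apply/negP => xy; apply: ny; exists y.
have y_small (eps : R) : 0 < eps -> exists K : nat, forall m, (K <= m)%N -> M (x + y m) < eps.
  move=> eps0; exists (Num.truncn eps^-1) => m Km; apply: lt_le_trans (hy m).2 _.
  rewrite invf_ple ?posrE ?ltr0Sn//.
  by rewrite (le_trans (ltW (truncnS_gt _)))// ler_nat ltnS.
have [m|eps eps0|l al yl] := ca y; first by have [] := hy m.
  have [|K hK] := y_small (eps / 2); first by lra.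
  exists K => m n /hK m1 /hK n1.
  have -> : y m - y n = (x + y m) - (x + y n) by rewrite opprD addrACA subrr add0r.
  by apply: (le_lt_trans (ppowD pE _ _)); rewrite ppowN//; lra.
have -> : x = - 1 *: l; last exact: spannedZ.
rewrite scaleN1r; apply/eqP; rewrite -addr_eq0; apply/eqP/(ppow_eq0 pE)/le_anti.
rewrite ppow_ge0 andbT; apply/ler_addgt0Pr => eps eps0; rewrite add0r.
have [|K1 h1] := y_small (eps / 2); first by lra.
have [|K2 h2] := yl (eps / 2); first by lra.
have := h1 (maxn K1 K2) (leq_maxl _ _); have := h2 (maxn K1 K2) (leq_maxr _ _).
set u := y _ => s2 s1; have -> : x + l = (x + u) - (u - l) by rewrite opprB addrA addrAC addrK.
by apply: (le_trans (ppowD pE _ _)); rewrite ppowN//; lra.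
Qed.

(** Separation of [x] from the span of [a] makes the coordinates along [x] of a
    Cauchy sequence a Cauchy sequence of scalars. *)
Lemma span_completeP a : span_complete a.
Proof.
elim: a => [|x a ca] u ua cu.
  exists 0 => //= eps eps0; exists 0%N => n _.
  by rewrite (ua n) subrr ppow0.
have [ax|nax] := pselect (spanned a x).
  have ua' m : spanned a (u m).
    by have [c hc] := ua m; rewrite -(subrK (c *: x) (u m)) addrC; exact: spannedP.
  by have [l al ul] := ca u ua' cu; exists l => //; exact: spanned_cons.
have [d d0 hd] := span_complete_separated ca nax.
have /choice[c hc] : forall m, exists c : R, spanned a (u m - c *: x) by [].
have [e e0|b cb] := @real_cauchy_conv c.
  have [|K hK] := cu (e `^ p * d); first by rewrite mulr_gt0// powR_gt0.
  exists K => m n Km Kn; have := hK _ _ Km Kn.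
  have := hd (c m - c n) _ (spannedB (hc m) (hc n)).
  have -> : (c m - c n) *: x + (u m - c m *: x - (u n - c n *: x)) = u m - u n.
    by rewrite scalerBl opprB addrA (addrC (_ - _) (u m - _)) !subrKA.
  move=> h1 h2; have := le_lt_trans h1 h2; rewrite ltr_pM2r//.
  by apply: contraTT; rewrite -!leNgt => h; rewrite ge0_ler_powR ?nnegrE// ltW.
have cx : pconv (fun m => c m *: x) (b *: x).
  move=> eps eps0; have [e e0 he] := powR_norm_lt_exists (ppow_ge0 p NE x) eps0.
  have [K hK] := cb _ e0; exists K => n /hK /he.
  by rewrite -ppowZ// scalerBl.
have ccx : pcauchy (fun m => c m *: x).
  move=> eps eps0; have [|K hK] := cx (eps / 2); first by lra.
  exists K => m n /hK m1 /hK n1.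
  apply: (le_lt_trans (ppowB_le pE _ (b *: x) _)).
  by rewrite [X in _ + X]ppowB//; lra.
have [l al ul] := ca (fun m => u m - c m *: x) hc (pcauchyB cu ccx).
exists (l + b *: x).
  by exists b; rewrite addrK.
have := pconvD ul cx; congr pconv; apply/funext => m.
by rewrite subrK.
Qed.

Lemma scalar_bounded_on_span a theta : exists2 L : R, 0 <= L &
  forall y, spanned a y -> `|theta y| `^ p <= L * M y.
Proof.
have pD := norm_powRD p_gt0 p_le1.
elim: a => [|x a [L L0 ih]].
  by exists 0 => // y ->; rewrite linear0 normr0 powR0 ?gt_eqF// mul0r.
have [ax|nax] := pselect (spanned a x).
  exists L => // y [c hc]; apply: ih.
  by rewrite -(subrK (c *: x) y) addrC; exact: spannedP.
have [d d0 hd] := span_complete_separated (@span_completeP a) nax.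
exists ((`|theta x| `^ p + L * M x) / d + L).
  by rewrite addr_ge0// divr_ge0 ?(ltW d0)// addr_ge0 ?powR_ge0// mulr_ge0 ?ppow_ge0.
move=> y [c hc]; have := hd c _ hc; rewrite addrC subrK => hy.
have e1 : `|theta y| `^ p <= `|c| `^ p * `|theta x| `^ p + L * M (y - c *: x).
  rewrite -powRM// -normrM -[y in leLHS](subrK (c *: x)) addrC linearP/=.
  by apply: (le_trans (pD _ _)); rewrite lerD2l ih.
have e2 : M (y - c *: x) <= M y + `|c| `^ p * M x.
  by apply: (le_trans (ppowD pE _ _)); rewrite ppowN// ppowZ.
have e3 : `|c| `^ p <= M y / d by rewrite ler_pdivlMr.
apply: (le_trans e1).
have k0 : 0 <= `|theta x| `^ p + L * M x.
  by rewrite addr_ge0 ?powR_ge0// mulr_ge0 ?ppow_ge0.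
have := ler_wpM2r k0 e3; have := ler_wpM2l L0 e2.
have -> : ((`|theta x| `^ p + L * M x) / d + L) * M y =
  M y / d * (`|theta x| `^ p + L * M x) + L * M y by field; rewrite gt_eqF.
by lra.
Qed.

Section Domination.
Variable C : R.
Hypothesis C_gt0 : 0 < C.
Hypothesis E_dominated : forall x (s : seq E),
  (forall phi : {scalar E}, `|phi x| `^ p <= \sum_(y <- s) `|phi y| `^ p) ->
  M x <= C * \sum_(y <- s) M y.

Lemma scalar_multiple phi (c : R) : exists psi : {scalar E}, forall x, psi x = c * phi x.
Proof. by apply: scalar_of => d x y; rewrite linearP/=; ring. Qed.

(** The contrapositive of [E_dominated], applied to the multiple of [b] on which
    [M] is twice the bound that domination would give. *)
Lemma norming_functional b (s : seq E) : b != 0 -> exists2 psi : {scalar E}, psi b = 1 &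
  (\sum_(x <- s) `|psi x| `^ p) * M b <= 2 * C * \sum_(x <- s) M x.
Proof.
move=> b0; have Mb := ppow_gt0 pE b0; set S := \sum_(x <- s) M x.
have S0 : 0 <= S by apply: sumr_ge0 => x _; exact: ppow_ge0.
have [S_eq0|S_neq0] := eqVneq S 0.
  have [phi phib] := scalar_separates b0.
  have [psi psiE] := scalar_multiple phi (phi b)^-1.
  exists psi; first by rewrite psiE mulVf.
  rewrite S_eq0 mulr0 big_seq big1 ?mul0r// => x xs.
  have x0 : M x = 0.
    apply/eqP; move: S_eq0 => /eqP; rewrite psumr_eq0; last by move=> ? _; exact: ppow_ge0.
    by move=> /allP/(_ x xs).
  by rewrite (ppow_eq0 pE x0) linear0 normr0 powR0// gt_eqF.
have Sgt0 : 0 < S by rewrite lt_def S_neq0.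
apply: contrapT => npsi.
have CS : 0 < C * S by rewrite mulr_gt0.
pose r := (2 * (C * S) / M b) `^ p^-1.
have rb0 : 0 <= 2 * (C * S) / M b by rewrite divr_ge0 ?ppow_ge0// mulr_ge0// ltW.
have rp : r `^ p = 2 * (C * S) / M b by rewrite powRVK.
have := @E_dominated (r *: b) s.
rewrite ppowZ// ger0_norm ?powR_ge0// rp divfK ?gt_eqF// -/S => /(_ _)/wrap[]; last by lra.
move=> phi; have [phib|phib] := eqVneq (phi b) 0.
  rewrite linearZ/= phib mulr0 normr0 powR0 ?gt_eqF//.
  by apply: sumr_ge0 => x _; exact: powR_ge0.
have [psi psiE] := scalar_multiple phi (phi b)^-1.
have h : 2 * C * S < (\sum_(x <- s) `|psi x| `^ p) * M b.
  rewrite ltNge; apply/negP => h; apply: npsi; exists psi => //.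
  by rewrite psiE mulVf.
rewrite linearZ/= normrM powRM// ger0_norm ?powR_ge0// rp.
have -> : \sum_(y <- s) `|phi y| `^ p =
    (\sum_(x <- s) `|psi x| `^ p) * `|phi b| `^ p.
  rewrite mulr_suml; apply: eq_bigr => x _.
  by rewrite -powRM// -normrM psiE mulrAC mulVf// mul1r.
rewrite ler_wpM2r ?powR_ge0// ler_pdivrMr//.
by lra.
Qed.

(** The vectors of the list are killed one at a time: [P] is followed by the
    projection along [P b] given by a norming functional [psi].  The estimate for
    [psi] is homogeneous in [P b], so the norm of [P b] cancels, and each step
    multiplies the constant by [1 + 2 * C] irrespective of [s]. *)
Lemma small_projection a : exists2 K : R, 0 <= K & forall s : seq E,
  exists P : {linear E -> E},
  [/\ forall x, x \in a -> P x = 0, forall x, spanned a (x - P x) &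
      \sum_(x <- s) M (P x) <= K * \sum_(x <- s) M x].
Proof.
elim: a => [|b a [K K0 ih]].
  exists 1 => // s; exists idfun; split=> //= [x|]; first by rewrite subrr.
  by rewrite mul1r.
exists (K * (1 + 2 * C)); first by rewrite mulr_ge0//; have := C_gt0; lra.
move=> s; have [P [Pa aP sP]] := ih s.
have S0 : 0 <= \sum_(x <- s) M x by apply: sumr_ge0 => x _; exact: ppow_ge0.
have [Pb|Pb] := eqVneq (P b) 0.
  exists P; split=> [x|x|]; first by rewrite inE => /orP[/eqP->|/Pa].
    exact: spanned_cons.
  apply: (le_trans sP); rewrite ler_wpM2r// ler_peMr//.
  by have := C_gt0; lra.
have [psi psib spsi] := norming_functional [seq P x | x <- s] Pb.
have [|Q QE] := @linear_of R E E (fun x => P x - psi (P x) *: P b).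
  by move=> c x y; rewrite !linearP/= scalerDl -scalerA scalerBr opprD addrACA.
exists Q; split=> [x|x|].
- rewrite inE QE => /orP[/eqP->|/Pa->]; last by rewrite linear0 scale0r subr0.
  by rewrite psib scale1r subrr.
- exists (psi (P x)).
  have -> : x - Q x - psi (P x) *: b = (x - P x) - psi (P x) *: (b - P b).
    by rewrite QE scalerBr !opprB (addrC (_ *: P b) (- P x)) !addrA.
  by apply: spannedB => //; exact: spannedZ.
rewrite !big_map in spsi.
apply: (@le_trans _ _ (\sum_(x <- s) (M (P x) + `|psi (P x)| `^ p * M (P b)))).
  apply: ler_sum => x _; rewrite QE; apply: (le_trans (ppowD pE _ _)).
  by rewrite ppowN// ppowZ.
rewrite big_split/= -mulr_suml.
have := C_gt0; nra.
Qed.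

(** The functional is [theta (x - P x)].  It agrees with [theta] on [a] because [P]
    kills [a], and it involves [theta] only on the span of [a], where [theta] is
    bounded. *)
Theorem small_extension a theta : exists2 K : R, 0 <= K & forall s : seq E,
  exists2 phi : {scalar E}, (forall x, x \in a -> phi x = theta x) &
    \sum_(x <- s) `|phi x| `^ p <= K * \sum_(x <- s) M x.
Proof.
have [L L0 hL] := scalar_bounded_on_span a theta.
have [K K0 hK] := small_projection a.
exists (L * (1 + K)); first by rewrite mulr_ge0// addr_ge0.
move=> s; have [P [Pa aP sP]] := hK s.
have [|phi phiE] := @scalar_of R E (fun x => theta (x - P x)).
  by move=> c x y; rewrite !(linearB theta) (linearP P) !(linearP theta)/=; ring.
exists phi; first by move=> x xa; rewrite phiE Pa// subr0.
apply: (@le_trans _ _ (\sum_(x <- s) L * (M x + M (P x)))).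
  apply: ler_sum => x _; rewrite phiE; apply: (le_trans (hL _ (aP x))).
  by rewrite ler_wpM2l// (le_trans (ppowD pE _ _))// ppowN.
rewrite -mulr_sumr big_split/= -mulrA ler_wpM2l//.
by lra.
Qed.

End Domination.

End FiniteSpan.

(** * Complete p-convex lattices from gauges *)

Section GaugeLattice.
Variables (R : realType) (p : R) (W : Type) (D : (W -> R) -> R -> Prop).
Hypotheses (p_gt0 : 0 < p) (p_le1 : p <= 1).
Hypothesis D_ge0 : forall f sigma, D f sigma -> 0 <= sigma.
Hypothesis D_zero : D (fun=> 0) 0.
Hypothesis D_mono : forall f sigma tau, sigma <= tau -> D f sigma -> D f tau.
Hypothesis D_add : forall f g h sigma tau, D f sigma -> D g tau ->
  (forall w, `|h w| `^ p <= `|f w| `^ p + `|g w| `^ p) -> D h (sigma + tau).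
Hypothesis D_scale : forall a f sigma, D f sigma ->
  D (fun w => a * f w) (`|a| `^ p * sigma).

Local Notation B := (fnlat R (nat * W)).
Implicit Types (F G H : B) (sigma tau : R).

(** [D f sigma] stands for: the p-th power of the size of [f] is at most [sigma].
    Sequences of functions on [W] are functions on [nat * W], measured by the
    limsup of the sizes of their terms.  Modulo null sequences they form a complete
    space whatever [D] is, so that nothing has to be completed. *)
Definition eventually_le F sigma := exists K : nat, forall m, (K <= m)%N ->
  D (fun w => F (m, w)) sigma.
Local Notation ev := eventually_le.

Lemma ev_ge0 F sigma : ev F sigma -> 0 <= sigma.
Proof. by move=> [K /(_ K (leqnn K)) /D_ge0]. Qed.

Lemma ev_zero : ev 0 0. Proof. by exists 0%N => m _; exact: D_zero. Qed.

Lemma ev_mono F sigma tau : sigma <= tau -> ev F sigma -> ev F tau.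
Proof. by move=> st [K hK]; exists K => m /hK; exact: D_mono. Qed.

Lemma ev_add F G H sigma tau : ev F sigma -> ev G tau ->
  (forall x, `|H x| `^ p <= `|F x| `^ p + `|G x| `^ p) -> ev H (sigma + tau).
Proof.
move=> [K1 h1] [K2 h2] HFG; exists (maxn K1 K2) => m.
rewrite geq_max => /andP[/h1 m1 /h2 m2].
by apply: (D_add m1 m2) => w; exact: HFG.
Qed.

Lemma ev_scale a F sigma : ev F sigma -> ev (a *: F) (`|a| `^ p * sigma).
Proof. by move=> [K hK]; exists K => m /hK; exact: D_scale. Qed.

Lemma ev_solid F G sigma : (forall x, `|F x| <= `|G x|) -> ev G sigma -> ev F sigma.
Proof.
move=> FG evG; rewrite -[sigma]addr0; apply: (ev_add evG ev_zero) => x.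
rewrite normr0 powR0 ?gt_eqF// addr0 ge0_ler_powR ?nnegrE//.
exact: ltW.
Qed.

Lemma ev_plus F G sigma tau : ev F sigma -> ev G tau -> ev (F + G) (sigma + tau).
Proof. by move=> evF evG; apply: (ev_add evF evG) => x; exact: norm_powRD. Qed.

Lemma ev_join F G sigma tau : ev F sigma -> ev G tau ->
  ev (vjoin F G) (sigma + tau).
Proof.
move=> evF evG; apply: (ev_add evF evG) => x.
rewrite -[leLHS]/(`|Num.max (F x) (G x)| `^ p).
have := powR_ge0 `|F x| p; have := powR_ge0 `|G x| p.
by have [_|_] := lerP (F x) (G x); lra.
Qed.

Lemma ev_power_sum n (F : 'I_n -> B) (sigma : 'I_n -> R) :
  (forall k, ev (F k) (sigma k)) ->
  ev (fun x => (\sum_(k < n) `|F k x| `^ p) `^ p^-1) (\sum_(k < n) sigma k).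
Proof.
move=> evF; elim: (index_enum _) => [|k r ih].
  have -> : (fun x => (\sum_(k <- [::]) `|F k x| `^ p) `^ p^-1) = 0 :> B.
    by apply/funext => x; rewrite big_nil powR0// invr_eq0 gt_eqF.
  by rewrite big_nil; exact: ev_zero.
rewrite big_cons; apply: (ev_add (evF k) ih) => x; rewrite big_cons.
have S0 s : 0 <= \sum_(i <- s) `|F i x| `^ p.
  by apply: sumr_ge0 => i _; exact: powR_ge0.
rewrite !(ger0_norm (powR_ge0 _ _)) !powRVK// addr_ge0 ?powR_ge0//.
Qed.

Let bounded F := exists sigma, ev F sigma.
Let null F := forall eps : R, 0 < eps -> ev F eps.

Fact boundedP a F G : bounded F -> bounded G -> bounded (a *: F + G).
Proof.
move=> [s hs] [t ht]; exists (`|a| `^ p * s + t); apply: ev_plus => //.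
exact: ev_scale.
Qed.

Fact boundedB F G : bounded F -> bounded G -> bounded (F - G).
Proof. by move=> bF bG; rewrite addrC -scaleN1r; exact: boundedP. Qed.

Fact boundedD F G : bounded F -> bounded G -> bounded (F + G).
Proof. by move=> bF bG; rewrite -[F]scale1r; exact: boundedP. Qed.

Fact bounded_join F G : bounded F -> bounded G -> bounded (vjoin F G).
Proof. by move=> [s hs] [t ht]; exists (s + t); exact: ev_join. Qed.

Fact nullP a F G : null F -> null G -> null (a *: F + G).
Proof.
move=> nF nG eps eps0; pose b := `|a| `^ p + 1.
have b0 : 0 < b by rewrite ltr_wpDl ?powR_ge0.
have h : eps = `|a| `^ p * (eps / b) + eps / b.
  by rewrite -[X in _ + X]mul1r -mulrDl mulrCA mulfV ?mulr1// gt_eqF.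
by rewrite h; apply: ev_plus; [apply/ev_scale/nF|apply: nG]; rewrite divr_gt0.
Qed.

Fact null_solid F G : vabs F <= vabs G -> null G -> null F.
Proof.
move=> /fn_leP FG nG eps eps0; apply: ev_solid (nG _ eps0) => x.
by have := FG x; rewrite !fn_absE.
Qed.

Fact bounded0 : bounded 0. Proof. by exists 0; exact: ev_zero. Qed.

Fact null0 : null 0.
Proof. by move=> eps eps0; apply: ev_mono (ltW eps0) ev_zero. Qed.

Definition gauge_quotient : subquotient B :=
  @Subquotient R B bounded null bounded0 boundedP bounded_join null0 nullP null_solid.

Local Notation Q := gauge_quotient.
Local Notation X := (sqtype Q).

Definition limsup_gauge F := inf [set sigma | ev F sigma].

Lemma limsup_le F sigma : ev F sigma -> limsup_gauge F <= sigma.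
Proof. by move=> h; apply: ge_inf => //; exists 0 => tau /ev_ge0. Qed.

Lemma limsup_lt F sigma : bounded F -> limsup_gauge F < sigma -> ev F sigma.
Proof.
move=> bF Fs; have e0 : 0 < sigma - limsup_gauge F by rewrite subr_gt0.
have [|t tF] := @inf_adherent _ [set sigma | ev F sigma] _ e0.
  by split=> //; exists 0 => tau /ev_ge0.
by rewrite addrC subrK => ts; apply: ev_mono tF; exact: ltW.
Qed.

Lemma limsup_ge0 F : bounded F -> 0 <= limsup_gauge F.
Proof. by move=> bF; apply: lb_le_inf => // tau /ev_ge0. Qed.

Lemma limsup_ev F eps : bounded F -> 0 < eps -> ev F (limsup_gauge F + eps).
Proof. by move=> bF eps0; apply: limsup_lt => //; rewrite ltrDl. Qed.

Lemma limsupD F G : bounded F -> bounded G -> limsup_gauge (F + G) <= limsup_gauge F + limsup_gauge G.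
Proof.
move=> bF bG; apply/ler_addgt0Pr => eps eps0; have e2 : 0 < eps / 2 by lra.
apply: limsup_le; have := ev_plus (limsup_ev bF e2) (limsup_ev bG e2).
by apply: ev_mono; lra.
Qed.

Lemma limsup_solid F G : bounded G -> (forall x, `|F x| <= `|G x|) -> limsup_gauge F <= limsup_gauge G.
Proof.
move=> bG FG; apply/ler_addgt0Pr => eps eps0; apply: limsup_le.
by apply: ev_solid FG _; exact: limsup_ev.
Qed.

Lemma limsup_null F : null F -> limsup_gauge F = 0.
Proof.
move=> nF; have bF : bounded F by exists 1; exact: nF.
apply/le_anti; rewrite limsup_ge0// andbT; apply/ler_addgt0Pr => eps eps0.
by rewrite add0r; exact/limsup_le/nF.
Qed.

Lemma limsup_null_sub F G : bounded F -> bounded G -> null (F - G) -> limsup_gauge F <= limsup_gauge G.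
Proof.
move=> bF bG nFG; rewrite -(subrK G F).
apply: (le_trans (limsupD _ _)) => //; first by exists 1; exact: nFG.
by rewrite (limsup_null nFG) add0r.
Qed.

Lemma limsupZ a F : bounded F -> limsup_gauge (a *: F) = `|a| `^ p * limsup_gauge F.
Proof.
have le b G : bounded G -> limsup_gauge (b *: G) <= `|b| `^ p * limsup_gauge G.
  move=> bG; apply/ler_addgt0Pr => eps eps0.
  have b0 := powR_ge0 `|b| p; have b1 : 0 < `|b| `^ p + 1 by lra.
  apply: limsup_le; apply: ev_mono (ev_scale b (limsup_ev bG (divr_gt0 eps0 b1))).
  rewrite mulrDr lerD2l mulrCA ler_piMr ?(ltW eps0)// ler_pdivrMr//; lra.
move=> bF; apply/le_anti; rewrite le//=.
have [->|a0] := eqVneq a 0.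
  rewrite normr0 powR0 ?gt_eqF// mul0r limsup_ge0//.
  by exists 0; rewrite scale0r; exact: ev_zero.
have baF : bounded (a *: F) by case: bF => s hs; exists (`|a| `^ p * s); exact: ev_scale.
have ap : `|a^-1| `^ p * `|a| `^ p = 1.
  by rewrite -powRM// -normrM mulVf// normr1 powR1.
have := ler_wpM2l (powR_ge0 `|a| p) (le a^-1 _ baF).
by rewrite scalerA mulVf// scale1r mulrA (mulrC (`|a| `^ p) (`|a^-1| `^ p)) ap mul1r.
Qed.

Definition gauge_pnorm (s : X) : R := limsup_gauge (sqval s).
Definition gauge_norm (s : X) : R := gauge_pnorm s `^ p^-1.

Lemma gauge_pnorm_cls F : bounded F -> gauge_pnorm (sqcls Q F) = limsup_gauge F.
Proof.
move=> bF; have bF' := sqval_mem (sqcls Q F); have nF := sqval_clsI (Q := Q) bF.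
apply/le_anti; rewrite !limsup_null_sub//.
by have := sqIN nF; rewrite opprB.
Qed.

Lemma gauge_pnorm_ge0 s : 0 <= gauge_pnorm s.
Proof. by apply: limsup_ge0; exact: (sqval_mem s). Qed.

Lemma gauge_ppow s : ppow p gauge_norm s = gauge_pnorm s.
Proof. by rewrite /ppow powRVK// gauge_pnorm_ge0. Qed.

Lemma gauge_normP : p_norm p gauge_norm.
Proof.
split=> [s|s|a s|s t].
- exact: powR_ge0.
- move=> /powR_eq0_eq0; elim/sq_ind: s => F bF; rewrite gauge_pnorm_cls// => F0.
  rewrite -(sqcls0 Q); apply/sqcls_eq => //; first exact: (sqA0 Q).
  by rewrite subr0 => eps eps0; apply: limsup_lt; rewrite ?F0.
- rewrite /gauge_norm; elim/sq_ind: s => F bF.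
  have b0 := sqA0 Q; have bZ : bounded (a *: F) by exact: (sqAZ (Q := Q)).
  have [] := sqclsP (Q := Q) a bF b0; rewrite addr0 sqcls0 addr0 => <- _ _.
  by rewrite !gauge_pnorm_cls// limsupZ// powRM ?powR_ge0 ?limsup_ge0// powRK.
rewrite -![_ `^ p]/(ppow p gauge_norm _) !gauge_ppow.
elim/sq_ind: s => F bF; elim/sq_ind: t => G bG.
have [] := sqclsP (Q := Q) 1 bF bG; rewrite !scale1r => <- _ _.
by rewrite !gauge_pnorm_cls ?limsupD//; exact: (sqAD (Q := Q)).
Qed.

Lemma gauge_lattice_norm : lattice_norm gauge_norm.
Proof.
move=> s t; elim/sq_ind: s => F bF; elim/sq_ind: t => G bG.
have bA H : bounded H -> bounded (vabs H) /\ limsup_gauge (vabs H) = limsup_gauge H.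
  move=> bH; have bVH : bounded (vabs H) by apply: (sqA_join (s := Q)) => //; exact: (sqAN (Q := Q)).
  split=> //; apply/le_anti; rewrite !limsup_solid// => x; rewrite fn_absE normr_id//.
have [bF' sF] := bA _ bF; have [bG' sG] := bA _ bG.
rewrite -(sqcls_abs (Q := Q) bF) -(sqcls_abs (Q := Q) bG) => /vjoin_idr.
have [_ <- _] := sqclsP (Q := Q) 0 bF' bG'.
have bJ : bounded (vjoin (vabs F) (vabs G)) by exact: bounded_join.
move=> /(congr1 gauge_pnorm); rewrite (gauge_pnorm_cls bJ) (gauge_pnorm_cls bG') sG => h.
rewrite /gauge_norm (gauge_pnorm_cls bF) (gauge_pnorm_cls bG).
apply: ge0_ler_powR; rewrite ?nnegrE ?limsup_ge0// ?invr_ge0 ?(ltW p_gt0)//.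
rewrite -h -sF; apply: limsup_solid => // x; rewrite fn_absE normr_id.
rewrite -[leRHS]/(`|Num.max (vabs F x) (vabs G x)|) !fn_absE.
by rewrite [leRHS]ger0_norm le_max ?normr_ge0 ?lexx.
Qed.

(** A diagonal argument.  Along a subsequence with representatives [F a], the
    differences [F b - F a] have size less than [c a] for [a <= b].  The limit takes
    at index [m] the value of the last [F t], with [t <= m], all of whose
    differences with its predecessors already satisfy these bounds at [m]. *)
Lemma gauge_complete : norm_complete gauge_norm.
Proof.
apply/(pnorm_complete p_gt0 gauge_normP) => u cu.
pose c (a : nat) : R := a.+1%:R^-1.
have c0 a : 0 < c a by rewrite invr_gt0 ltr0Sn.
have /choice[K hK] : forall a, exists K : nat, forall m n, (K <= m)%N -> (K <= n)%N ->
    gauge_pnorm (u m - u n) < c a.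
  move=> a; have [K hK] := cu _ (c0 a); exists K => m n Km Kn.
  by rewrite -gauge_ppow; exact: hK.
(* A nondecreasing choice of indices. *)
pose k a := (\max_(i < a.+1) K i)%N.
have Kk a b : (a <= b)%N -> (K a <= k b)%N.
  move=> ab; have ab1 : (a < b.+1)%N by [].
  exact: (leq_bigmax (F := fun i : 'I_b.+1 => K i) (Ordinal ab1)).
pose F a : B := sqval (u (k a)).
have bF a : bounded (F a) by exact: (sqval_mem (u (k a))).
have bFF a b : bounded (F b - F a) by exact: boundedB.
have uF a : u (k a) = sqcls Q (F a) by rewrite sqvalK.
have clsB G H : bounded G -> bounded H -> sqcls Q G - sqcls Q H = sqcls Q (G - H).
  move=> bG bH; have [] := sqclsP (Q := Q) (-1) bH bG.
  by rewrite !scaleN1r addrC => -> _ _; rewrite addrC.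
have evF a b : (a <= b)%N -> ev (F b - F a) (c a).
  move=> ab; apply: limsup_lt => //; rewrite -gauge_pnorm_cls// -clsB// -!uF.
  by apply: hK; apply: Kk.
(* [P i m]: at index [m], the first [i] differences obey their bounds. *)
pose P i m := forall a b, (a <= b <= i)%N -> D (fun w => F b (m, w) - F a (m, w)) (c a).
have P0 m : P 0%N m.
  move=> a b /andP[ab]; rewrite leqn0 => /eqP b0; move: ab; rewrite b0 leqn0 => /eqP->.
  apply: (D_mono (ltW (c0 0%N))).
  by rewrite (_ : (fun w => _) = fun=> 0)//; apply/funext => w; rewrite subrr.
have evP i : exists L : nat, forall m, (L <= m)%N -> P i m.
  have /choice[L hL] : forall ab : 'I_i.+1 * 'I_i.+1, exists L : nat, forall m,
      (L <= m)%N -> (ab.1 <= ab.2)%N -> D (fun w => F ab.2 (m, w) - F ab.1 (m, w)) (c ab.1).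
    move=> [a b]; have [ab|ab] := boolP (a <= b)%N; last by exists 0%N => m _ /= h; case/negP: ab.
    by have [L hL] := evF _ _ ab; exists L => m /hL.
  exists (\max_ab L ab)%N => m Lm a b /andP[ab bi].
  have bi1 : (b < i.+1)%N by []; have ai1 : (a < i.+1)%N by exact: leq_trans bi1.
  apply: (hL (Ordinal ai1, Ordinal bi1)) => //.
  by apply: leq_trans Lm; exact: leq_bigmax.
have /choice[tau htau] : forall m, exists t, P t m /\ forall i, (i <= m)%N -> P i m -> (i <= t)%N.
  move=> m; pose q i := (i <= m)%N && `[< P i m >].
  have q0 : exists i, q i by exists 0%N; apply/andP; split=> //; exact/asboolP.
  have qm i : q i -> (i <= m)%N by case/andP.
  case: (ex_maxnP q0 qm) => t /andP[tm /asboolP Pt] tmax.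
  exists t; split=> // i im Pi; apply: tmax; rewrite /q im/=.
  exact/asboolP.
pose G : B := fun x => F (tau x.1) x.
have evG a : ev (G - F a) (c a).
  have [L hL] := evP a; exists (maxn L a) => m; rewrite geq_max => /andP[/hL Pa am].
  have [Pt tmax] := htau m.
  by apply: (Pt a (tau m)); rewrite leqnn andbT; exact: tmax.
have bG : bounded G.
  by rewrite -(subrK (F 0%N) G); apply: boundedD => //; exists (c 0%N).
exists (sqcls Q G) => eps eps0.
have [a ca] : exists a, c a + c a < eps.
  pose t : R := (Num.truncn (2 / eps)).+1%:R.
  have t0 : 0 < t by rewrite ltr0Sn.
  have ht : 2 / eps < t by exact: truncnS_gt.
  exists (Num.truncn (2 / eps)); change (t^-1 + t^-1 < eps).
  have -> : t^-1 + t^-1 = 2 / t by rewrite mulrDl mul1r.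
  by rewrite ltr_pdivrMr// mulrC -ltr_pdivrMr.
exists (k a) => n kn; apply: (le_lt_trans (ppowB_le gauge_normP _ (u (k a)) _)).
rewrite !gauge_ppow; apply: lt_trans ca; apply: ltr_leD.
  by apply: hK; [exact: leq_trans (Kk a a _) kn|exact: Kk].
rewrite uF clsB// gauge_pnorm_cls; last first.
  exact: boundedB.
have := evG a => /limsup_le; apply: le_trans; apply: limsup_solid.
  by exists (c a).
by move=> x; change (`|F a x - G x| <= `|G x - F a x|); rewrite distrC.
Qed.

(** Every Krivine calculus on the quotient acts pointwise on representatives: on
    lattice-linear functions by algebra, and on the p-sum by monotonicity and
    density.  The representative p-sum obeys the bound by [ev_power_sum]. *)
Lemma gauge_convex : p_convexity_constant p gauge_norm 1.
Proof.
split=> // n x z [Phi [Phi_coord PhiP] ->{z}]; rewrite mul1r.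
pose h (t : 'rV[R]_n) := (\sum_(k < n) `|t ord0 k| `^ p) `^ p^-1.
have hh : homogeneous_continuous h by exact: hc_power_sum.
pose row (y : nat * W) : 'rV[R]_n := \row_k sqval (x k) y.
have Phi0 : Phi (fun=> 0) = 0.
  have [/(_ 1) + _ _] := PhiP _ _ (hc_zero R n) (hc_zero R n).
  rewrite scale1r mulr0 addr0 => /eqP; rewrite -subr_eq0 opprD addrA subrr sub0r.
  by rewrite oppr_eq0 => /eqP.
have Phi_le f g : homogeneous_continuous f -> homogeneous_continuous g ->
    (forall t, f t <= g t) -> Phi f <= Phi g.
  move=> hf hg fg; apply/vjoin_idr; have [_ <- _] := PhiP _ _ hf hg.
  by congr Phi; apply/funext => t; rewrite max_r.
have Phi_ll g : lattice_linear g ->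
    bounded (fun y => g (row y)) /\ Phi g = sqcls Q (fun y => g (row y)).
  elim=> [|k|a f f' lf [bf hf] lf' [bf' hf']|f f' lf [bf hf] lf' [bf' hf']|
          f f' lf [bf hf] lf' [bf' hf']].
  - by split; [exact: (sqA0 Q)|rewrite Phi0].
  - have -> : (fun y => row y ord0 k) = sqval (x k) by apply/funext => y; rewrite mxE.
    by split; [exact: (sqval_mem (x k))|rewrite sqvalK].
  - split; first exact: boundedP.
    have [/(_ a) -> _ _] := PhiP _ _ (ll_hc lf) (ll_hc lf').
    by rewrite hf hf'; have [<- _ _] := sqclsP (Q := Q) a bf bf'.
  - split; first exact: bounded_join.
    have [_ -> _] := PhiP _ _ (ll_hc lf) (ll_hc lf').
    by rewrite hf hf'; have [_ <- _] := sqclsP (Q := Q) 0 bf bf'.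
  - split; first exact: (sqA_meet (Q := Q)).
    have [_ _ ->] := PhiP _ _ (ll_hc lf) (ll_hc lf').
    by rewrite hf hf'; have [_ _ <-] := sqclsP (Q := Q) 0 bf bf'.
pose U : B := fun y => l1norm (row y); pose H : B := fun y => h (row y).
have [bU PhiU] := Phi_ll _ (ll_l1norm R n).
have bx k : bounded (sqval (x k)) by exact: (sqval_mem (x k)).
have evH eps : 0 < eps -> ev H (\sum_(k < n) (gauge_pnorm (x k) + eps)).
  move=> eps0; suff -> : H = fun y => (\sum_(k < n) `|sqval (x k) y| `^ p) `^ p^-1.
    exact: (ev_power_sum (fun k => limsup_ev (bx k) eps0)).
  apply/funext => y; rewrite /H /h; congr (_ `^ _).
  by apply: eq_bigr => k _; rewrite mxE.
have bH : bounded H by exists (\sum_(k < n) (gauge_pnorm (x k) + 1)); exact: evH.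
have main : gauge_pnorm (Phi h) <= limsup_gauge H.
  apply: (small_le p_gt0 (a := 0) (b := 2 * limsup_gauge U)) => //.
    by rewrite mulr_ge0// limsup_ge0.
  move=> d d0; rewrite mul0r addr0.
  have [g lg hg] := lattice_linear_dense hh d0; have [bg Phig] := Phi_ll _ lg.
  have hgc := ll_hc lg; have lU := ll_hc (ll_l1norm R n).
  set gF : B := fun y => g (row y) in bg Phig.
  have e1 : gauge_pnorm (Phi h) <= gauge_pnorm (Phi g) + d `^ p * limsup_gauge U.
    have Phi_dU : vabs (Phi h - Phi g) <= d *: Phi (@l1norm R n).
      rewrite vabs_le opprB (vleBlE (Phi h)) (vleBlE (Phi g)); apply/andP; split.
        have [/(_ d) <- _ _] := PhiP _ _ lU hgc.
        apply: Phi_le => //; first exact: hc_lin.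
        by move=> t; have := hg t; rewrite ler_norml; lra.
      have [/(_ d) <- _ _] := PhiP _ _ lU hh.
      apply: Phi_le => //; first exact: hc_lin.
      by move=> t; have := hg t; rewrite ler_norml; lra.
    rewrite -!gauge_ppow -[Phi h](subrK (Phi g)) addrC.
    apply: (le_trans (ppowD gauge_normP _ _)); rewrite lerD2l.
    have -> : d `^ p * limsup_gauge U = ppow p gauge_norm (d *: Phi (@l1norm R n)).
      by rewrite (ppowZ gauge_normP) gtr0_norm// gauge_ppow PhiU gauge_pnorm_cls.
    apply: (ppow_le p_gt0 gauge_normP gauge_lattice_norm).
    by apply: (le_trans Phi_dU); exact: vabs_ge.
  have e2 : limsup_gauge gF <= limsup_gauge H + d `^ p * limsup_gauge U.
    rewrite -[X in X `^ p](gtr0_norm d0) -limsupZ//.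
    have bdU : bounded (d *: U) by exact: (sqAZ (Q := Q)).
    have bgH : bounded (gF - H) by exact: boundedB.
    rewrite -[gF](subrK H) addrC; apply: (le_trans (limsupD _ _)) => //.
    rewrite lerD2l; apply: limsup_solid => // y.
    rewrite -[leLHS]/(`|g (row y) - h (row y)|) -[leRHS]/(`|d * l1norm (row y)|).
    by rewrite [leRHS]ger0_norm ?mulr_ge0 ?l1norm_ge0 ?(ltW d0)// distrC.
  by move: e1; rewrite Phig gauge_pnorm_cls//; lra.
have HS : limsup_gauge H <= \sum_(k < n) gauge_pnorm (x k).
  apply: (small_le p_gt0 (a := n%:R) (b := 0)) => // d d0.
  rewrite mulr0 addr0; apply: (le_trans (limsup_le (evH _ d0))).
  by rewrite big_split/= sumr_const card_ord mulr_natl.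
rewrite /gauge_norm ge0_ler_powR ?nnegrE ?gauge_pnorm_ge0//.
- by rewrite invr_ge0 ltW.
- by apply: sumr_ge0 => k _; exact: powR_ge0.
apply: (le_trans main); apply: (le_trans HS); apply: ler_sum => k _.
by rewrite powRVK ?gauge_pnorm_ge0.
Qed.

Theorem gauge_p_convex_p_Banach_lattice : p_convex_p_Banach_lattice p gauge_norm.
Proof.
split; last by exists 1; exact: gauge_convex.
split; last exact: gauge_lattice_norm.
by split; [exact: gauge_normP|exact: gauge_complete].
Qed.

End GaugeLattice.

(** * Density and injectivity *)

Section Density.
Variables (R : realType) (p : R) (E : lmodType R) (NE : E -> R).
Variables (F : vectorLatticeType R) (NF : F -> R) (delta : {linear E -> F}).
Variables (V : vectorLatticeType R) (j : {linear V -> F}).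
Hypotheses (p_gt0 : 0 < p) (F_free : is_FpBL p NE NF delta).
Hypotheses (hom_j : lattice_hom j) (j_onto : forall e, exists v, j v = delta e).
Local Notation M := (ppow p NF).

Let pF : p_norm p NF. Proof. by case: F_free => -[[[]]]. Qed.
Let cF : norm_complete NF. Proof. by case: F_free => -[[[]]]. Qed.
Let lF : lattice_norm NF. Proof. by case: F_free => -[[]]. Qed.

Definition closure_range : set F :=
  [set x | forall eps : R, 0 < eps -> exists v, M (x - j v) < eps].
Local Notation A := closure_range.

Lemma closure_range_mem v : A (j v).
Proof. by move=> eps eps0; exists v; rewrite subrr ppow0. Qed.

Lemma closure_rangeP (a : R) x y : A x -> A y -> A (a *: x + y).
Proof.
move=> Ax Ay eps eps0; have a0 := powR_ge0 `|a| p.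
have b0 : 0 < `|a| `^ p + 1 by lra.
have [v xv] := Ax _ (divr_gt0 eps0 b0); have [w yw] := Ay _ (divr_gt0 eps0 b0).
exists (a *: v + w); rewrite linearP opprD addrACA -scalerBr.
apply: (le_lt_trans (ppowD pF _ _)); rewrite ppowZ//.
have h := ler_wpM2l a0 (ltW xv).
have -> : eps = `|a| `^ p * (eps / (`|a| `^ p + 1)) + eps / (`|a| `^ p + 1).
  by field; rewrite gt_eqF.
exact: ler_ltD.
Qed.

Lemma closure_range_join x y : A x -> A y -> A (vjoin x y).
Proof.
move=> Ax Ay eps eps0; have e2 : 0 < eps / 2 by lra.
have [v xv] := Ax _ e2; have [w yw] := Ay _ e2.
exists (vjoin v w); rewrite hom_join//.
by apply: (le_lt_trans (ppow_join p_gt0 pF lF _ _ _ _)); lra.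
Qed.

Lemma closure_range_closed (u : nat -> F) l : (forall n, A (u n)) ->
  (forall eps : R, 0 < eps -> exists K : nat, forall n, (K <= n)%N -> M (u n - l) < eps) ->
  A l.
Proof.
move=> Au ul eps eps0; have e2 : 0 < eps / 2 by lra.
have [K hK] := ul _ e2; have [v hv] := Au K _ e2; exists v.
apply: (le_lt_trans (ppowB_le pF _ (u K) _)); rewrite (ppowB pF).
by have := hK K (leqnn K); lra.
Qed.


(** The closure is a p-convex p-Banach lattice for the induced norm, since a Krivine
    calculus on it is one on [F] after inclusion. *)
Lemma free_closure_range x : A x.
Proof.
have A0 : A 0 by rewrite -(linear0 j); exact: closure_range_mem.
pose Q := sublattice A0 closure_rangeP closure_range_join.
have [i [hom_i iE]] : exists i : {linear sqtype Q -> F},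
  lattice_hom i /\ forall s, i s = sqval s by exact: sub_incl.
pose NG (s : sqtype Q) := NF (i s).
have ppowG s : ppow p NG s = M (i s) by [].
have i_inj s : i s = 0 -> s = 0.
  move=> is0; rewrite -(sqvalK s) -iE is0; exact: sqcls0.
have pG : p_norm p NG.
  have [N0 Neq0 NZ ND] := pF; split=> [s|s|a s|s t]; rewrite /NG.
  - exact: N0.
  - by move=> /Neq0; exact: i_inj.
  - by rewrite linearZ NZ.
  - by rewrite linearD ND.
have cG : norm_complete NG.
  apply/(pnorm_complete p_gt0 pG) => u cu.
  have [|l ul] := (pnorm_complete p_gt0 pF).1 cF (fun n => i (u n)).
    move=> eps /cu[K hK]; exists K => m n Km Kn.
    by have := hK _ _ Km Kn; rewrite ppowG linearB.
  have Al : A l.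
    by apply: closure_range_closed ul => n; rewrite iE; exact: (sqval_mem (u n)).
  exists (sqcls Q l) => eps /ul[K hK]; exists K => n /hK h.
  by rewrite ppowG linearB (iE (sqcls Q l)) sub_clsK.
have G_lattice : p_convex_p_Banach_lattice p NG.
  split; first split=> //.
    move=> s t st; apply: lF; rewrite -!(hom_abs hom_i).
    exact: hom_le.
  have [[_ [C [C0 hC]]] _ _ _] := F_free; exists C; split=> // n y z [Phi [Phi1 Phi2] ->{z}].
  apply: (hC n (fun k => i (y k))); exists (fun h => i (Phi h)) => //; split=> [k|f g hf hg].
    by rewrite Phi1.
  have [Phi_lin Phi_max Phi_min] := Phi2 f g hf hg; split=> [a||].
  - by rewrite Phi_lin linearP.
  - by rewrite Phi_max hom_join.
  - by rewrite Phi_min hom_meet.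
have Adelta e : A (delta e) by have [v <-] := j_onto e; exact: closure_range_mem.
have [c cE] := @sq_lift R F Q E delta Adelta.
have icE e : i (c e) = delta e by rewrite iE cE sub_clsK.
have [F_lattice _ iso univ] := F_free.
have contc : Defs.norm_continuous NE NG c.
  move=> e eps eps0; by exists eps => // e'; rewrite -iso /NG -linearB icE.
have contd : Defs.norm_continuous NE NF delta.
  by move=> e eps eps0; exists eps => // e'; rewrite -iso linearB.
have [h [hom_h hE _ _]] := univ _ NG c G_lattice contc.
have [k [_ _ kU _]] := univ _ NF delta F_lattice contd.
have idF : lattice_hom (idfun : {linear F -> F}) by [].
have <- : i (h x) = x.
  rewrite -[RHS]/((idfun : {linear F -> F}) x) (kU _ idF)//.
  rewrite -[LHS]/((i \o h) x); apply: kU; first exact: lattice_hom_comp.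
  by move=> e; rewrite /= hE icE.
by rewrite iE; exact: (sqval_mem (h x)).
Qed.

Theorem free_lattice_dense : norm_dense NF (range j).
Proof.
move=> x eps eps0; have [v hv] := free_closure_range x (powR_gt0 p eps0).
by exists (j v); [exists v|rewrite -(pnorm_ppow_lt p_gt0 pF)].
Qed.

End Density.

Section Injectivity.
Variables (R : realType) (p : R) (E : lmodType R) (NE : E -> R).
Variables (V : vectorLatticeType R) (iota : {linear E -> V}).
Hypotheses (p_gt0 : 0 < p) (p_le1 : p <= 1) (pE : p_norm p NE).
Hypothesis V_free : is_FVL iota.
Local Notation M := (ppow p NE).

(** The infimum of these [sigma] is the p-th power of the largest p-convex lattice
    seminorm, with constant 1, that is at most [NE] on the vectors of [E] seen as
    functions on the algebraic dual. *)
Definition dominated (f : {scalar E} -> R) (sigma : R) : Prop :=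
  exists2 s : seq E, \sum_(x <- s) M x <= sigma &
    forall phi, `|f phi| `^ p <= \sum_(x <- s) `|phi x| `^ p.

Lemma dominated_ge0 f sigma : dominated f sigma -> 0 <= sigma.
Proof.
move=> [s + _]; apply: le_trans; apply: sumr_ge0 => x _; exact: ppow_ge0.
Qed.

Lemma dominated_zero : dominated (fun=> 0) 0.
Proof.
by exists [::]; rewrite ?big_nil// => phi; rewrite big_nil normr0 powR0// gt_eqF.
Qed.

Lemma dominated_mono f sigma tau : sigma <= tau -> dominated f sigma -> dominated f tau.
Proof. by move=> st [s /le_trans ss fs]; exists s => //; exact: ss. Qed.

Lemma dominated_add f g h sigma tau : dominated f sigma -> dominated g tau ->
  (forall phi, `|h phi| `^ p <= `|f phi| `^ p + `|g phi| `^ p) ->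
  dominated h (sigma + tau).
Proof.
move=> [s ss fs] [t tt gt] hfg; exists (s ++ t); first by rewrite big_cat lerD.
by move=> phi; rewrite big_cat (le_trans (hfg phi))// lerD.
Qed.

Lemma dominated_scale a f sigma : dominated f sigma ->
  dominated (fun phi => a * f phi) (`|a| `^ p * sigma).
Proof.
have a0 := powR_ge0 `|a| p.
move=> [s ss fs]; exists [seq a *: x | x <- s].
  rewrite big_map (eq_bigr (fun x => `|a| `^ p * M x)); last by move=> x _; rewrite ppowZ.
  by rewrite -mulr_sumr ler_wpM2l.
move=> phi; rewrite big_map (eq_bigr (fun x => `|a| `^ p * `|phi x| `^ p)).
  by rewrite -mulr_sumr normrM powRM// ler_wpM2l.
by move=> x _; rewrite linearZ/= normrM powRM.
Qed.

Definition dominated_quotient : subquotient (fnlat R (nat * {scalar E})) :=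
  gauge_quotient p_gt0 p_le1 dominated_zero dominated_mono dominated_add dominated_scale.
Local Notation Q := dominated_quotient.
Local Notation NX := (@gauge_norm R p {scalar E} dominated p_gt0 p_le1
  dominated_zero dominated_mono dominated_add dominated_scale).

Definition tautological (e : E) : fnlat R (nat * {scalar E}) := fun y => y.2 e.

Lemma tautological_linear (a : R) x y :
  tautological (a *: x + y) = a *: tautological x + tautological y.
Proof. by apply/funext => z; rewrite /tautological linearP. Qed.

Lemma tautological_bounded e : eventually_le dominated (tautological e) (M e).
Proof.
exists 0%N => m _; exists [:: e]; first by rewrite big_seq1.
by move=> phi; rewrite big_seq1.
Qed.

Section Detection.
Variable C : R.
Hypothesis C_gt0 : 0 < C.
Hypothesis E_dominated : forall x (s : seq E),
  (forall phi : {scalar E}, `|phi x| `^ p <= \sum_(y <- s) `|phi y| `^ p) ->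
  M x <= C * \sum_(y <- s) M y.

(** If [v] were not below [0], take [theta] and [s] from [FVL_not_le0].  If [t]
    dominates a term of [H v], the value of this term at a functional that equals
    [theta] on [s] and is small on [t] is at least [mu], and yet small. *)
Lemma null_le0 (H : {linear V -> fnlat R (nat * {scalar E})}) v :
  lattice_hom H -> (forall e, H (iota e) = tautological e) ->
  (forall eps : R, 0 < eps -> eventually_le dominated (H v) eps) -> v <= 0.
Proof.
move=> hom_H HE null_v; apply: contrapT => /(FVL_not_le0 V_free).
move=> [s [theta [mu [mu0 theta_s /(_ _ H hom_H) Hv]]]].
have [K K0 hK] := small_extension p_gt0 p_le1 pE C_gt0 E_dominated s theta.
have K1 : 0 < K + 1 by lra.
have mup : 0 < mu `^ p by rewrite powR_gt0.
have [m /(_ m (leqnn m))[t tM Ht]] := null_v _ (divr_gt0 mup K1).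
have [phi phi_s phi_t] := hK t.
have mu_le : mu <= H v (m, phi).
  by apply: Hv => x xs; rewrite HE -[leRHS]/(phi x) phi_s// theta_s.
have h1 : mu `^ p <= `|H v (m, phi)| `^ p.
  apply: ge0_ler_powR; rewrite ?nnegrE ?(ltW p_gt0) ?(ltW mu0)//.
  exact: le_trans (ler_norm _).
have h2 := le_trans h1 (le_trans (Ht phi) phi_t).
have h3 := le_trans h2 (ler_wpM2l K0 tM).
have : K * (mu `^ p / (K + 1)) < mu `^ p.
  by rewrite mulrCA gtr_pMr// ltr_pdivrMr// mul1r; lra.
by rewrite ltNge h3.
Qed.

(** [T e] is the class of the constant sequence with terms [phi |-> phi e].  The
    extension of [T] sends [v] to the class of the function of [v], and [null_le0]
    applies to [v] and to [- v]. *)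
Theorem free_lattice_faithful : exists (X : vectorLatticeType R) (N : X -> R)
    (T : {linear E -> X}),
  [/\ p_convex_p_Banach_lattice p N, forall e, N (T e) <= NE e &
      forall h : {linear V -> X}, lattice_hom h -> (forall e, h (iota e) = T e) ->
      forall v, h v = 0 -> v = 0].
Proof.
have [tau tauE] := linear_of tautological_linear.
have Qtau e : sqA Q (tau e) by exists (M e); rewrite tauE; exact: tautological_bounded.
have [T TE] := @sq_lift _ _ Q E tau Qtau.
exists (sqtype Q), NX, T; split.
- exact: (gauge_p_convex_p_Banach_lattice p_gt0 p_le1 dominated_ge0).
- move=> e; rewrite TE -[leRHS](powRK p_gt0) ?(pnorm_ge0 pE)//.
  apply: ge0_ler_powR; rewrite ?nnegrE ?powR_ge0 ?invr_ge0 ?(ltW p_gt0)//.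
    exact: (gauge_pnorm_ge0 dominated_ge0).
  rewrite (gauge_pnorm_cls _ _ dominated_ge0); last exact: Qtau.
  by apply: (limsup_le dominated_ge0); rewrite tauE; exact: tautological_bounded.
move=> h hom_h hE.
have [H hom_H HE] := FVL_extension V_free tau.
have QH v : sqA Q (H v).
  elim: (FVL_joins V_free v) => [w|v1 v2 _ ih1 _ ih2].
    elim=> [e|v1 v2 _ ih1 _ ih2]; first by rewrite HE.
    by rewrite hom_meet//; exact: (sqA_meet (Q := Q)).
  by rewrite hom_join//; exact: (sqA_join (s := Q)).
have [k kE] := @sq_lift _ _ Q V H QH.
have hom_k : lattice_hom k.
  move=> v w; rewrite !kE (hom_join hom_H) (hom_meet hom_H).
  by have [_ -> ->] := sqclsP (Q := Q) 0 (QH v) (QH w).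
have hk : h =1 k.
  by apply: (FVL_unique V_free) => // e; rewrite hE TE kE HE.
have le0 v : h v = 0 -> v <= 0.
  rewrite hk kE -(sqcls0 Q) => /(sqcls_eq (QH v) (sqA0 Q)).
  rewrite subr0 => null_v; apply: (null_le0 hom_H) => // e.
  by rewrite HE tauE.
move=> v hv; apply/le_anti; rewrite le0//=.
by rewrite -vleN2 oppr0 le0// linearN hv oppr0.
Qed.

End Detection.

End Injectivity.

Theorem proposition4p10 (R : realType) (p : R) (p_gt0 : 0 < p) (p_le1 : p <= 1)
    (E : lmodType R) (NE : E -> R)
    (E_qBanach : quasi_Banach NE) (E_natural : p_natural p NE)
    (F : vectorLatticeType R) (NF : F -> R) (delta : {linear E -> F})
    (F_free : is_FpBL p NE NF delta)
    (V : vectorLatticeType R) (iota : {linear E -> V})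
    (V_free : is_FVL iota) :
  exists j : {linear V -> F},
    [/\ lattice_hom j,
        forall e, j (iota e) = delta e,
        forall S : {linear V -> F}, lattice_hom S ->
          (forall e, S (iota e) = delta e) -> S =1 j,
        injective j &
        norm_dense NF (range j)].
Proof.
have [j hom_j jE] := FVL_extension V_free delta.
have [[[[pF cF] lF] F_convex] _ iso univ] := F_free.
exists j; split=> //.
- by move=> S hom_S SE; apply: (FVL_unique V_free) => // e; rewrite SE jE.
- have pE : p_norm p NE.
    have [N0 _ NZ ND] := pF; have [[NE0 NEeq0 _ _] _] := E_qBanach.
    split=> // [a e|e e']; first by rewrite -!iso linearZ NZ.
    by rewrite -!iso linearD ND.
  have [hat hom_hat hatE] := FVL_as_functions V_free.
  have [C C_gt0 hC] := domination p_gt0 V_free hom_j hom_hat hatE pF cF lF F_convex.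
  have [|X [N [T [X_lattice T_le T_inj]]]] :=
    @free_lattice_faithful R p E NE V iota p_gt0 p_le1 pE V_free C C_gt0.
    move=> x s dom; have := hC x s dom; rewrite /ppow jE iso.
    by under eq_bigr do rewrite jE iso.
  have contT : Defs.norm_continuous NE N T.
    move=> e eps eps0; exists eps => // e' ee'.
    by rewrite -linearB; exact: le_lt_trans (T_le _) ee'.
  have [That [hom_That ThatE _ _]] := univ _ N T X_lattice contT.
  move=> v w jvw; apply/subr0_eq; apply: (T_inj (That \o j)).
  + exact: lattice_hom_comp.
  + by move=> e; rewrite /= jE ThatE.
  + by rewrite /= linearB jvw subrr linear0.
- by apply: (free_lattice_dense p_gt0 F_free hom_j) => e; exists (iota e).
Qed.
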